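(* Let $\Gamma$ be a metric graph of genus $g$. The set $\Sigma$ of break divisors on $\Gamma$ is equal to the closure, in $\operatorname{Div}^g_+(\Gamma)$, of the set of universally reduced divisors on $\Gamma$.
   Context: A metric graph $\Gamma$ arises from a weighted graph model $G$ (finite connected graph without loops, positive edge lengths) by gluing segments; genus $g=|E(G)|-|V(G)|+1$. $\operatorname{Div}^g_+(\Gamma)$ is the set of effective divisors of degree $g$, identified with the symmetric product $\Gamma^g/S_g$ and given the quotient topology. A break divisor is a divisor $(p_1)+\cdots+(p_g)$ such that, for some model $G$ and spanning tree $T$ of $G$ with complementary edges $e_1,\dots,e_g$, $p_i$ lies in the closed edge $\bar e_i$ for each $i$. Linear equivalence: $R(\Gamma)$ is the group of continuous piecewise affine integer-slope functions, $\Delta(f)=\sum_p\sigma_p(f)(p)$ with $-\sigma_p(f)$ the sum of slopes of $f$ in all tangent directions at $p$, and $D\sim D'$ iff $D-D'=\Delta(f)$. For $q\in\Gamma$, $D$ is $q$-reduced if $D(p)\ge 0$ for all $p\ne q$ and for every closed connected $X\subseteq\Gamma$ with $q\notin X$ there is $p\in\partial X$ with $D(p)$ less than the number of tangent directions at $p$ leaving $X$. A divisor is universally reduced if it has degree $g$, is effective, and is $q$-reduced for every $q\in\Gamma$. *)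

(* Defs.v *)
From HB Require Import structures.
From mathcomp Require Import all_boot all_order all_algebra perm finmap.
From mathcomp Require Import all_classical all_reals topology.
From mathcomp Require Import normedtype.
From mathcomp Require Import freeg.

Set Implicit Arguments.
Unset Strict Implicit.
Unset Printing Implicit Defensive.

Import Order.TTheory GRing.Theory Num.Theory.
Import numFieldTopology.Exports numFieldNormedType.Exports.

Local Open Scope classical_set_scope.
Local Open Scope ring_scope.

(* Parallel edges are allowed, loops are not.  [src] and [tgt] fix an arbitrary
   orientation of each edge, used only to parametrize it. *)
Record wgraph (R : realType) := WGraph {
  vertex : finType;
  edge : finType;
  src : edge -> vertex;
  tgt : edge -> vertex;
  len : edge -> R;
  len_gt0 : forall e, 0 < len e;
  src_neq_tgt : forall e, src e != tgt e;
  vertex_gt0 : (0 < #|vertex|)%N;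
  wgraph_connected : forall u v : vertex,
    connect [rel x y | [exists e, ((src e == x) && (tgt e == y))
                               || ((src e == y) && (tgt e == x))]] u v
}.

Section WGraphTheory.
Context {R : realType}.
Variable G : wgraph R.

Definition genus : nat := (#|edge G| + 1 - #|vertex G|)%N.

Definition adj (T : {set edge G}) : rel (vertex G) :=
  [rel x y | [exists e in T, ((src e == x) && (tgt e == y))
                          || ((src e == y) && (tgt e == x))]].

Definition dart : Type := (edge G * bool)%type.
Definition dart_src (d : dart) : vertex G := if d.2 then src d.1 else tgt d.1.
Definition dart_tgt (d : dart) : vertex G := if d.2 then tgt d.1 else src d.1.

Definition graph_cycle (T : {set edge G}) (c : seq dart) : bool :=
  [&& c != [::],
      all (fun d => d.1 \in T) c,
      uniq [seq d.1 | d <- c],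
      uniq [seq dart_src d | d <- c]
    & cycle [rel d d' : dart | dart_tgt d == dart_src d'] c].

Definition spanning_tree (T : {set edge G}) : Prop :=
  (forall u v, connect (adj T) u v) /\ (forall c, ~~ graph_cycle T c).

End WGraphTheory.

(* Lengths of the chains of segments joining two points of a space covered by
   the arcs [par e @` `[0, len e]]; the gluing metric is their infimum. *)
Inductive chain {R : realType} (G : wgraph R) (X : Type)
    (par : edge G -> R -> X) (x : X) : X -> R -> Prop :=
| chain_nil : chain par x x 0
| chain_step e s t l : 0 <= s <= len e -> 0 <= t <= len e ->
    chain par x (par e s) l -> chain par x (par e t) (l + `|t - s|).

(* [Gamma] is obtained from [graph] by gluing the segments [0, len e], with
   [par e] the canonical map of the segment of [e]; it is only meaningful on
   [0, len e]. *)
Record model {R : realType} (Gamma : metricType R) := Model {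
  graph :> wgraph R;
  vtx : vertex graph -> Gamma;
  par : edge graph -> R -> Gamma;
  par_src : forall e, par e 0 = vtx (src e);
  par_tgt : forall e, par e (len e) = vtx (tgt e);
  vtx_inj : injective vtx;
  vtx_notin_par : forall e s v, 0 < s < len e -> par e s <> vtx v;
  par_inj : forall e s e' s', 0 < s < len e -> 0 < s' < len e' ->
    par e s = par e' s' -> e = e' /\ s = s';
  model_cover : forall x : Gamma,
    (exists v, x = vtx v) \/ (exists e s, 0 < s < len e /\ x = par e s);
  model_mdist : forall x y : Gamma,
    mdist x y = inf [set l | chain par x y l]
}.

Definition closed_edge {R : realType} (Gamma : metricType R) (G : model Gamma)
    (e : edge G) : set Gamma :=
  [set par e s | s in [set s | 0 <= s <= len e]].

Definition metric_graph {R : realType} (Gamma : metricType R) (g : nat) : Prop :=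
  exists G : model Gamma, genus G = g.

Definition effective {T : choiceType} (D : {freeg T}) : bool := fgle 0 D.

Definition effdiv (T : choiceType) (g : nat) : Type :=
  {D : {freeg T} | effective D && (deg D == g%:Z)}.

HB.instance Definition _ (T : choiceType) g := SubChoice.on (effdiv T g).

Section EffDivQuotient.
Variables (T : choiceType) (g : nat).

Lemma effective_sum (I : Type) (r : seq I) (P : pred I) (F : I -> {freeg T}) :
  (forall i, P i -> effective (F i)) -> effective (\sum_(i <- r | P i) F i).
Proof.
move=> F0; apply/fgposP => z; rewrite raddf_sum sumr_ge0// => i Pi.
exact/fgposP/F0.
Qed.

Lemma effectiveU (x : T) : effective (<< x >> : {freeg T}).
Proof. by apply/fgposP => z; rewrite coeffU mul1r ler0n. Qed.

Lemma sum_points_subproof (p : 'I_g -> T) :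
  effective (\sum_i << p i >> : {freeg T}) &&
  (deg (\sum_i << p i >> : {freeg T}) == g%:Z).
Proof.
rewrite effective_sum/=; last by move=> i _; exact: effectiveU.
rewrite raddf_sum; under eq_bigr do rewrite /= degU.
by rewrite sumr_const card_ord natz.
Qed.

Definition sum_points (p : 'I_g -> T) : effdiv T g :=
  Sub (\sum_i << p i >>) (sum_points_subproof p).

Lemma sum_points_surj (D : effdiv T g) : exists p, sum_points p = D.
Proof.
case: D => D Dg; have /andP[/fgposP D0 /eqP degD] := Dg.
pose s := flatten [seq nseq `|coeff z D|%N z | z <- dom D].
have sD : \sum_(x <- s) << x >> = D.
  rewrite /s big_flatten/= big_map -[RHS]freeg_sumE; apply: eq_bigr => z _.
  apply/eqP/freeg_eqP => y; rewrite big_nseq iter_addr addr0.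
  by rewrite raddfMn/= !coeffU -mulrnAl (natz (absz _)) gez0_abs.
have szs : size s == g.
  rewrite -eqz_nat -degD -sD raddf_sum; under eq_bigr do rewrite /= degU.
  by rewrite big_const_seq count_predT iter_addr addr0 natz.
exists (tnth (Tuple szs)); apply: val_inj => /=.
by rewrite -[RHS]sD -(big_tuple _ _ (Tuple szs) xpredT (fun x => << x >>)).
Qed.

(* The fibres of [sum_points] are the orbits of the symmetric group, so that
   [effdiv T g] is the symmetric product. *)
Lemma sum_points_fibre (p p' : 'I_g -> T) :
  sum_points p = sum_points p' <-> exists s : 'S_g, p' = p \o s.
Proof.
split=> [/(congr1 val)/= pp'|[s ->]]; last first.
  by apply: val_inj => /=; rewrite (reindex_inj (@perm_inj _ s)).
have cnt (q : 'I_g -> T) z :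
    coeff z (\sum_i << q i >> : {freeg T}) =
    (count_mem z [tuple q i | i < g])%:Z.
  rewrite raddf_sum; under eq_bigr do rewrite /= coeffU mul1r.
  rewrite -natr_sum natz; congr Posz.
  rewrite -sum1_count big_tuple [RHS]big_mkcond /=.
  by apply: eq_bigr => i _; rewrite tnth_mktuple; case: eqP.
have /tuple_permP[s es] : perm_eq [tuple p' i | i < g] [tuple p i | i < g].
  apply/allP => z _ /=; apply/eqP.
  by have [] : (count_mem z [tuple p' i | i < g])%:Z =
               (count_mem z [tuple p i | i < g])%:Z by rewrite -!cnt pp'.
exists s; apply/funext => i /=.
have := congr1 (fun t : g.-tuple T => tnth t i) (val_inj es).
by rewrite !tnth_mktuple.
Qed.

Definition some_points (D : effdiv T g) : 'I_g -> T :=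
  projT1 (cid (sum_points_surj D)).

Lemma some_pointsK : cancel some_points sum_points.
Proof. by move=> D; exact: projT2 (cid (sum_points_surj D)). Qed.

HB.instance Definition _ :=
  isQuotient.Build ('I_g -> T) (effdiv T g) some_pointsK.

End EffDivQuotient.

(* The effective divisors of degree [g], with the quotient topology of the
   product topology along [sum_points]. *)
Definition Divplus (T : topologicalType) (g : nat) : topologicalType :=
  quotient_topology (effdiv T g : quotType ({ptws 'I_g -> T})).

Lemma open_DivplusE (T : topologicalType) (g : nat) (U : set (Divplus T g)) :
  open U = open ([set p | U (sum_points p)] : set {ptws 'I_g -> T}).
Proof. by rewrite [LHS]/open/= /quotient_open pi.unlock. Qed.

Definition divisor {T : topologicalType} {g : nat} (D : Divplus T g) :
  {freeg T} := sval (D : effdiv T g).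

Definition break_divisor {R : realType} {Gamma : metricType R}
    (D : {freeg Gamma}) : Prop :=
  exists (G : model Gamma) (T : {set edge G}) (p : edge G -> Gamma),
    [/\ spanning_tree T,
        forall e, e \notin T -> closed_edge e (p e)
      & D = \sum_(e | e \notin T) << p e >>].

Section Reduced.
Context {R : realType}.
Variable Gamma : metricType R.
Implicit Types (p q : Gamma) (X : set Gamma) (D : {freeg Gamma}).

(* Unit speed parametrizations of segments issuing from [p]; two of them define
   the same tangent direction when they agree near 0. *)
Definition emanating p : set (R -> Gamma) :=
  [set gam | gam 0 = p /\ exists2 eps : R, 0 < eps &
    forall s t, 0 <= s <= eps -> 0 <= t <= eps ->
      mdist (gam s) (gam t) = `|s - t|].

Definition same_direction (gam gam' : R -> Gamma) : Prop :=
  \forall t \near (0 : R)^'+, gam t = gam' t.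

Definition tangent_directions p : set (set (R -> Gamma)) :=
  [set emanating p `&` same_direction gam | gam in emanating p].

Definition leaves X (v : set (R -> Gamma)) : Prop :=
  forall gam, v gam -> \forall t \near (0 : R)^'+, ~ X (gam t).

Definition outdeg X p : nat :=
  #|` fset_set [set v | tangent_directions p v /\ leaves X v] |%fset.

Definition boundary X : set Gamma := closure X `\` X°.

Definition q_reduced q D : Prop :=
  (forall p, p <> q -> 0 <= coeff p D) /\
  (forall X, X !=set0 -> closed X -> connected X -> ~ X q ->
     exists2 p, boundary X p & coeff p D < (outdeg X p)%:Z).

Definition universally_reduced (g : nat) D : Prop :=
  [/\ deg D = g%:Z, effective D & forall q, q_reduced q D].

End Reduced.

(* Main.v *)
(* Universally reduced divisors are break divisors of every fixed model G.
   Firing a point, or the segment between two chips, of an open edge shows that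
   such an edge carries at most one chip.  Let K be the set of edges without
   interior chip.  For a connected set A of vertices, fire the edges inside A
   and the part up to the chip of the edges leaving A: some v in A has fewer
   chips than K-edges leaving A, which is Dhar's criterion for (V, K).  As it
   holds for every base vertex, the chips of any proper A, plus #|A|, number at
   most the K-edges touching A, so Hakimi's theorem orients K with indegree
   D(v) + 1 at v <> q and D(q) at q.  All vertices are reachable from q, and an
   arborescence rooted at q is the required spanning tree.  For fixed G the
   break divisors form a closed set, a finite union of images of products of
   closed edges.

   Conversely, moving each p_i into the interior of its edge approximates a
   break divisor by one whose support S has connected complement.  If
   D >= outdeg_X on the boundary of X, then the boundary lies in S, so X
   contains the complement of S or is contained in S; in the first case X is
   Gamma, in the second X leaves each of its points in two directions, against
   D = 1. *)
Require Import Defs.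
From HB Require Import structures.
From mathcomp Require Import all_boot all_order all_algebra perm finmap.
From mathcomp Require Import all_classical all_reals topology normedtype.
From mathcomp Require Import freeg.
From mathcomp Require Import zify ring lra.

Set Implicit Arguments.
Unset Strict Implicit.
Unset Printing Implicit Defensive.

Import Order.TTheory GRing.Theory Num.Theory.
Import numFieldNormedType.Exports.

Local Open Scope ring_scope.

(** * Orientations of finite graphs *)

Section Orientation.
Import mathcomp.boot.fintype mathcomp.boot.finset.
Local Open Scope nat_scope.
Variables (V E : finType) (s t : E -> V).
Implicit Types (K T : {set E}) (A B : {set V}) (d : V -> nat).
Implicit Types (o : E -> bool) (q v : V).

Definition head o e := if o e then t e else s e.
Definition tail o e := if o e then s e else t e.
Definition indegree K o v := #|[set e in K | head o e == v]|.
Definition incident K A := [set e in K | (s e \in A) || (t e \in A)].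

Lemma card_incident_le K A : #|incident K A| <= #|K|.
Proof. by rewrite subset_leq_card// /incident setIdE subsetIl. Qed.

Lemma card_incidentD1 K e A : e \in K ->
  #|incident K A| = ((s e \in A) || (t e \in A)) + #|incident (K :\ e) A|.
Proof.
move=> eK; rewrite (cardsD1 e) inE eK /=; congr (_ + #|pred_of_set _|).
by apply/setP => f; rewrite !inE andbA.
Qed.

Lemma card_incident_submodular K A B :
  #|incident K (A :|: B)| + #|incident K (A :&: B)| <=
  #|incident K A| + #|incident K B|.
Proof.
rewrite -(cardsUI (incident K A)); apply: leq_add; apply: subset_leq_card.
  by apply/subsetP => e; rewrite !inE; do 5?case: (_ \in _).
apply/subsetP => e; rewrite !inE => /andP[->].
by case/orP=> /andP[-> ->]; rewrite ?orbT.
Qed.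

Lemma sum_setUI d A B : \sum_(v in A :|: B) d v + \sum_(v in A :&: B) d v =
  \sum_(v in A) d v + \sum_(v in B) d v.
Proof.
rewrite !(big_mkcond (fun v => v \in _))/= -!big_split/=.
by apply: eq_bigr => v _; rewrite !inE; do 2 case: (_ \in _); rewrite ?addn0.
Qed.

(* A set violating the claim for an end of [e] is tight, meets [e] and avoids
   that end; by submodularity the two ends cannot both have one. *)
Lemma exists_relaxed_head K d e : e \in K ->
    (forall A, \sum_(v in A) d v <= #|incident K A|) ->
  exists b, forall A,
    \sum_(v in A) d v <= (head (fun=> b) e \in A) + #|incident (K :\ e) A|.
Proof.
move=> eK dle; apply: contrapT => /forallNP nb.
have [A nA] := (existsNP _).2 (nb false).
have [B nB] := (existsNP _).2 (nb true).
have [] := (dle (A :|: B), dle (A :&: B)); have [] := (dle A, dle B).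
have := card_incident_submodular (K :\ e) A B; have := sum_setUI d A B.
move: nA nB => /negP + /negP; rewrite -!ltnNge /= !(card_incidentD1 _ eK) !inE.
by case: (s e \in A); case: (t e \in A); case: (s e \in B); case: (t e \in B);
  rewrite /=; lia.
Qed.

Lemma hakimi_orientation K d :
    (forall A, \sum_(v in A) d v <= #|incident K A|) -> \sum_v d v = #|K| ->
  exists o, forall v, indegree K o v = d v.
Proof.
have [n] := ubnP #|K|; elim: n K d => // n IH K d; rewrite ltnS => Kn dle dK.
have [K0|[e eK]] := set_0Vmem K.
  exists xpredT => v; rewrite /indegree K0 setIdE set0I cards0.
  move/eqP: dK; rewrite K0 cards0 sum_nat_eq0 => /forallP/(_ v)/eqP.
  by rewrite /= => ->.
have [b relaxed] := exists_relaxed_head eK dle; pose u := head (fun=> b) e.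
have Ke : #|K| = #|K :\ e|.+1 by rewrite (cardsD1 e) eK.
have d_gt0 : 0 < d u.
  have := relaxed [set~ u]; rewrite -/u !inE eqxx add0n => due.
  have : \sum_(v in [set~ u]) d v <= #|K :\ e|.
    exact: leq_trans due (card_incident_le _ _).
  move: dK; rewrite (bigD1 u)//= Ke (eq_bigl (fun v => v \in [set~ u])) => [|v].
    by lia.
  by rewrite !inE.
have d_dec A : \sum_(v in A) d v = \sum_(v in A) (d v - (v == u)) + (u \in A).
  have [uA|uA] := boolP (u \in A); last first.
    by rewrite addn0; apply: eq_bigr => v;
      case: eqP uA => [-> /negbTE ->|_ _ _]; rewrite ?subn0.
  rewrite !(big_setD1 u uA)/= eqxx -addnA [X in _ - _ + X]addnC addnA subnK//.
  by congr (_ + _); apply: eq_bigr => v; rewrite !inE => /andP[/negbTE -> _];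
    rewrite subn0.
have [|A||o oE] := IH (K :\ e) (fun v => d v - (v == u));
  first by rewrite -ltnS -Ke.
- by have := relaxed A; rewrite d_dec -/u addnC leq_add2l.
- have := d_dec setT; rewrite inE.
  under eq_bigl do rewrite inE; under [in RHS]eq_bigl do rewrite inE.
  by rewrite dK Ke addn1 => -[].
exists (fun f => if f == e then b else o f) => v.
have -> : indegree K (fun f => if f == e then b else o f) v =
    (v == u) + indegree (K :\ e) o v.
  rewrite /indegree (cardsD1 e) !inE eK /head eqxx eq_sym;
    congr (_ + #|pred_of_set _|).
  by apply/setP => f; rewrite !inE; case: (f == e).
by rewrite oE; case: eqP => [->|_]; rewrite /= ?subn0// subnKC.
Qed.

Lemma sum_indegree K o A :
  \sum_(v in A) indegree K o v = #|[set e in K | head o e \in A]|.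
Proof.
rewrite -sum1_card (partition_big (head o) (mem A)) => [|e];
  last by rewrite inE => /andP[].
apply: eq_bigr => v vA; rewrite sum1dep_card; apply: eq_card => e; rewrite !inE.
by case: eqP => [->|_]; rewrite ?vA ?andbT ?andbF.
Qed.

Definition exits K A v := [set e in K |
  (s e == v) && (t e \notin A) || (t e == v) && (s e \notin A)].

Lemma card_exits_incidentD1 K A v : v \in A ->
  #|exits K A v| + #|incident K (A :\ v)| <= #|incident K A|.
Proof.
move=> vA; rewrite -cardsUI (_ : _ :&: _ = set0) ?cards0 ?addn0; last first.
  apply/setP => e; rewrite !inE; case: (e \in K) => //=.
  by do 2 case: eqP => //= _; case: (s e \in A); case: (t e \in A).
apply/subset_leq_card/subsetP => e; rewrite !inE; case: (e \in K) => //=.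
by case/orP=> [/orP[]/andP[/eqP -> _]|/orP[]/andP[_ ->]]; rewrite ?vA ?orbT.
Qed.

(* No set of vertices can fire when each [v] holds [d v] chips: for every [q],
   [d] is superstable with respect to [q]. *)
Definition unfireable K d := forall A, A != set0 -> A != setT ->
  exists2 v, v \in A & d v < #|exits K A v|.

(* The vertices of [A] leave it in the order of Dhar's burning algorithm. *)
Lemma unfireable_incident K d A : unfireable K d -> A != setT ->
  \sum_(v in A) (d v).+1 <= #|incident K A|.
Proof.
move=> dK; have [n] := ubnP #|A|; elim: n A => // n IH A; rewrite ltnS => An AT.
have [->|A0] := eqVneq A set0; first by rewrite big_set0.
have [v vA dv] := dK _ A0 AT; rewrite (big_setD1 v)//=.
apply: leq_trans (leq_add dv _) (card_exits_incidentD1 K vA); apply: IH.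
  by rewrite (cardsD1 v) vA in An.
by apply/eqP => /setP/(_ v); rewrite !inE eqxx.
Qed.

Definition flow K o : rel V :=
  [rel u v | [exists e in K, (tail o e == u) && (head o e == v)]].

(* A set containing [q] that no edge leaves is the head of all the edges it
   meets, one fewer than [unfireable_incident] requires. *)
Lemma unfireable_flow_connect K o d q v : unfireable K d ->
  (forall v, indegree K o v = d v + (v != q)) -> connect (flow K o) q v.
Proof.
move=> dK oE; pose B := [set u | connect (flow K o) q u].
suff BT : B = setT by have := in_setT v; rewrite -BT inE.
apply/eqP; apply: contraT => /(unfireable_incident dK).
rewrite leqNgt => /negP[].
have qB : q \in B by rewrite inE connect0.
have -> : incident K B = [set e in K | head o e \in B].
  apply/setP => e; rewrite !in_set; have [eK|//] := boolP (e \in K); rewrite /=.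
  have tail_head : tail o e \in B -> head o e \in B.
    rewrite !in_set => qe; apply: connect_trans qe (connect1 _).
    by apply/existsP; exists e; rewrite eK !eqxx.
  move: tail_head; rewrite !in_set /tail /head.
  by case: (o e) => h; apply/orP/idP; by [case|right|left|case=> // /h].
rewrite -sum_indegree (eq_bigr _ (fun v _ => oE v)) !(big_setD1 q qB)/=.
rewrite eqxx addn0 -addSn leq_add// leq_sum// => u _.
by case: (u != q); rewrite ?addn1 ?addn0.
Qed.

Definition arborescence o q T := [/\ {in T &, injective (head o)},
  head o @: T = [set~ q] &
  exists depth : V -> nat,
    {in T, forall e, depth (tail o e) < depth (head o e)}].

Lemma exists_depth (r : rel V) q : (forall v, connect r q v) ->
  exists depth : V -> nat,
    forall v, v != q -> exists2 u, r u v & depth u < depth v.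
Proof.
move=> qr.
pose reach v n := `[< exists p, [/\ path r q p, last q p = v & size p = n] >].
have reachP v : exists n, reach v n.
  by have /connectP[p rp ->] := qr v; exists (size p); apply/asboolP; exists p.
exists (fun v => ex_minn (reachP v)) => v vq.
case: (ex_minnP (reachP v)) => n /asboolP[p [rp pv <-{n}]] _.
case/lastP: p => [|p u] in rp pv *; first by rewrite -pv eqxx in vq.
move: rp pv; rewrite rcons_path last_rcons size_rcons => /andP[rp ru] <-.
exists (last q p) => //; case: ex_minnP => m _ m_min.
by rewrite ltnS; apply/m_min/asboolP; exists p.
Qed.

Lemma exists_inj_imset (f : E -> V) K :
  exists T, [/\ T \subset K, {in T &, injective f} & f @: T = f @: K].
Proof.
pose rep e := [pick e' in K | f e' == f e].
exists [set e in K | rep e == Some e]; split.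
- by rewrite setIdE subsetIl.
- move=> e e'; rewrite !inE => /andP[_ /eqP re] /andP[_ /eqP re'] ff.
  by move: re'; rewrite /rep -ff -/(rep e) re => -[].
apply/setP => v; apply/imsetP/imsetP => [[e + ->]|[e eK ->]].
  by rewrite inE => /andP[eK _]; exists e.
have [e' re /andP[e'K /eqP e'e]] : 
    exists2 e', rep e = Some e' & (e' \in K) && (f e' == f e).
  rewrite /rep; case: pickP => [e' ?|/(_ e)]; first by exists e'.
  by rewrite eK eqxx.
by exists e'; rewrite // inE e'K /rep e'e -/(rep e) re eqxx.
Qed.

Lemma exists_arborescence K o q : (forall v, connect (flow K o) q v) ->
  exists2 T : {set E}, T \subset K & arborescence o q T.
Proof.
move=> /exists_depth[depth depthP].
pose K' :=
  [set e in K | (head o e != q) && (depth (tail o e) < depth (head o e))].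
have [T [TK' Tinj TE]] := exists_inj_imset (head o) K'.
exists T; first by apply: subset_trans TK' _; rewrite /K' setIdE subsetIl.
split=> //.
  rewrite TE; apply/setP => v; rewrite !inE; apply/imsetP/idP => [[e]|vq].
    by rewrite !inE => /and3P[_ eq _] ->.
  have [u /existsP[e /and3P[eK /eqP eu /eqP ev]] uv] := depthP _ vq.
  by exists e; rewrite // !inE eK eu ev vq.
by exists depth => e /(subsetP TK'); rewrite !inE => /and3P[].
Qed.

Lemma indegreeD_arborescence K T o q v : T \subset K -> arborescence o q T ->
  indegree K o v = indegree (K :\: T) o v + (v != q).
Proof.
move=> TK [Tinj TE _]; rewrite {1}/indegree -(cardsID T) addnC.
have -> : [set e in K | head o e == v] :\: T =
    [set e in K :\: T | head o e == v].
  by apply/setP => e; rewrite !inE; case: (e \in T); rewrite ?andbF.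
have -> : [set e in K | head o e == v] :&: T = [set e in T | head o e == v].
  apply/setP => e; rewrite !inE; have [/(subsetP TK) ->|] := boolP (e \in T).
    by rewrite andbT.
  by rewrite andbF.
congr (_ + _); have [vT|vT] := boolP (v \in head o @: T); last first.
  rewrite (_ : v != q = false); last first.
    by move: vT; rewrite TE !inE negbK => /eqP ->; rewrite eqxx.
  apply/eqP; rewrite cards_eq0; apply/eqP/setP => e; rewrite !inE.
  by apply: contraNF vT => /andP[eT /eqP <-]; exact: imset_f.
rewrite (_ : v != q); last by move: vT; rewrite TE !inE.
case/imsetP: vT => e eT ->; rewrite (_ : [set e' in T | _] = [set e]) ?cards1//.
apply/setP => e'; rewrite !inE.
by apply/andP/eqP => [[e'T /eqP/Tinj]|->]; [exact|rewrite eT].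
Qed.

End Orientation.

Section SpanningTree.
Import mathcomp.boot.fintype mathcomp.boot.finset.
Local Open Scope nat_scope.
Context {R : realType}.
Variable G : wgraph R.
Implicit Types (K T : {set edge G}) (o : edge G -> bool) (q u v : vertex G).
Implicit Types d : dart G.

Local Notation head := (head (@src _ G) (@tgt _ G)).
Local Notation tail := (tail (@src _ G) (@tgt _ G)).
Local Notation indegree := (indegree (@src _ G) (@tgt _ G)).
Local Notation arborescence := (arborescence (@src _ G) (@tgt _ G)).

Lemma dart_src_neq_tgt d : dart_src d != dart_tgt d.
Proof.
by rewrite /dart_src /dart_tgt; case: ifP => _;
  rewrite ?src_neq_tgt// eq_sym src_neq_tgt.
Qed.

Lemma adj_sym T : symmetric (adj T).
Proof. by move=> u v; apply: eq_existsb => e /=; rewrite orbC. Qed.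

Lemma adjP T u v :
  reflect (exists d, [/\ d.1 \in T, dart_src d = u & dart_tgt d = v])
    (adj T u v).
Proof.
apply: (iffP existsP) => [[e /andP[eT]]|[[e b] [/= eT <- <-]]].
  by case/orP=> /andP[/eqP eu /eqP ev]; [exists (e, true)|exists (e, false)].
by exists e; rewrite eT /dart_src /dart_tgt; case: b; rewrite !eqxx ?orbT.
Qed.

Lemma card_vertex_le : #|vertex G| <= #|edge G|.+1.
Proof.
have /card_gt0P[q _] := vertex_gt0 G.
have [v|depth depthP] := @exists_depth _ (adj [set: edge G]) q.
  apply: connect_sub (wgraph_connected q v) => u w /existsP[e uw].
  by apply/connect1/existsP; exists e; rewrite inE.
pose deeper_end e := if depth (src e) < depth (tgt e) then tgt e else src e.
have reach_all : [set~ q] \subset deeper_end @: [set: edge G].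
  apply/subsetP => v; rewrite !inE => /depthP[u /adjP[[e b] [_ du dv]] uv].
  apply/imsetP; exists e => //; rewrite /deeper_end.
  move: uv; rewrite -du -dv /dart_src /dart_tgt /=; case: (b) => [->//|vu].
  by rewrite ltnNge ltnW.
have := leq_trans (subset_leq_card reach_all) (leq_imset_card _ _).
by rewrite cardsT cardsCs setCK cards1 leq_subLR.
Qed.

Lemma arborescence_connect o q T u v : arborescence o q T ->
  connect (adj T) u v.
Proof.
move=> [_ TE [depth depthP]].
have toq w : connect (adj T) w q.
  have [n] := ubnP (depth w); elim: n w => // n IH w; rewrite ltnS => wn.
  have [->//|wq] := eqVneq w q.
  have : w \in head o @: T by rewrite TE !inE.
  case/imsetP => e eT we; apply: connect_trans (IH (tail o e) _).
    rewrite we; apply/connect1/adjP; exists (e, ~~ o e).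
    by rewrite /head /tail /dart_src /dart_tgt /=; case: (o e).
  by apply: leq_trans wn; rewrite we depthP.
by apply: connect_trans (toq u) _; rewrite (sym_connect_sym (@adj_sym T)).
Qed.

(* The two edges of a cycle at its deepest vertex would both have it as head. *)
Lemma arborescence_acyclic o q T c : arborescence o q T -> ~~ graph_cycle T c.
Proof.
move=> [Tinj _ [depth depthP]].
apply/negP => /and5P[c0 /allP cT cE _ cyc].
have [d0 d0c] : exists d, d \in c
  by case: c c0 {cT cE cyc} => // d c _; exists d; exact: mem_head.
have [d dc d_deepest] :=
  arg_maxnP (P := mem c) (fun d => depth (dart_src d)) d0c.
have src_le x : x \in c -> depth (dart_src x) <= depth (dart_src d)
  by exact: d_deepest.
have head_dart x : x \in c ->
    depth (dart_src x) < depth (dart_tgt x) /\ head o x.1 = dart_tgt x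
    \/ depth (dart_tgt x) < depth (dart_src x) /\ head o x.1 = dart_src x.
  move=> /cT/depthP; rewrite /head /tail /dart_src /dart_tgt.
  by case: (o x.1); case: x.2; [left|right|right|left].
pose d' := prev c d; have d'c : d' \in c by rewrite mem_prev.
have tgt_prev : dart_tgt d' = dart_src d by exact/eqP/(prev_cycle cyc dc).
have tgt_d : dart_tgt d = dart_src (next c d) by exact/eqP/(next_cycle cyc dc).
have head_d : head o d.1 = dart_src d.
  have [[+ _]|[]//] := head_dart _ dc.
  by rewrite tgt_d ltnNge src_le// mem_next.
have head_prev : head o d'.1 = dart_src d.
  have [[_]|[+ _]] := head_dart _ d'c; rewrite tgt_prev// ltnNge.
  by rewrite src_le.
have prev_eq : d = d'.
  have edge_eq : d.1 = d'.1 by apply: Tinj; rewrite ?cT// head_d head_prev.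
  have index_lt x : x \in c -> index x c < size [seq y.1 | y <- c]
    by rewrite size_map index_mem.
  rewrite -[LHS](nth_index d dc) -[RHS](nth_index d d'c); congr nth.
  apply: (uniqP d.1 cE) => //; rewrite ?inE ?index_lt//.
  by rewrite !(nth_map d) ?index_mem// !nth_index.
by have := dart_src_neq_tgt d'; rewrite tgt_prev -prev_eq eqxx.
Qed.

Lemma unfireable_spanning_tree K (d : vertex G -> nat) :
    #|K|.+1 = \sum_v d v + #|vertex G| ->
    unfireable (@src _ G) (@tgt _ G) K d ->
  exists (T : {set edge G}) o, [/\ spanning_tree T, T \subset K
    & forall v, indegree (K :\: T) o v = d v].
Proof.
move=> Kd dK; have /card_gt0P[q _] := vertex_gt0 G.
have sum_d1 (A : {set vertex G}) :
    \sum_(v in A) (d v + (v != q)) <= \sum_(v in A) (d v).+1.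
  by apply: leq_sum => v _; case: (v != q); rewrite ?addn1 ?addn0.
have sumV : \sum_v (d v + (v != q)) = #|K|.
  apply: succn_inj; rewrite Kd -sum1_card -big_split/=.
  rewrite (bigD1 q)//= [RHS](bigD1 q)//=.
  rewrite eqxx addn0 addn1 -addSn; congr (_ + _).
  by apply: eq_bigr => v ->.
have sum_incident (A : {set vertex G}) :
    \sum_(v in A) (d v + (v != q)) <= #|incident (@src _ G) (@tgt _ G) K A|.
  have [->|AT] := eqVneq A setT;
    last exact: leq_trans (sum_d1 A) (unfireable_incident dK AT).
  rewrite (eq_bigl xpredT) ?sumV => [|v]; last by rewrite inE.
  by rewrite subset_leq_card//; apply/subsetP => e eK; rewrite !inE eK.
have [o oE] := hakimi_orientation sum_incident sumV.
have [T TK Tq] :=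
  exists_arborescence (fun v => unfireable_flow_connect v dK oE).
exists T, o; split=> //.
  split=> [u v|c];
    [exact: arborescence_connect Tq|exact: arborescence_acyclic Tq].
move=> v; apply/eqP; rewrite -(eqn_add2r (v != q)).
by rewrite -(indegreeD_arborescence v TK Tq) oE.
Qed.

End SpanningTree.

Section InducedSubgraphs.
Import mathcomp.boot.fintype mathcomp.boot.finset.
Context {R : realType}.
Variable G : wgraph R.
Implicit Types (K : {set edge G}) (A : {set vertex G}).
Implicit Types (u v w : vertex G) (d : dart G).

Local Notation exits := (exits (@src _ G) (@tgt _ G)).

Lemma exitsP K A v e : reflect
  (exists d, [/\ d.1 = e, e \in K, dart_src d = v & dart_tgt d \notin A])
  (e \in exits K A v).
Proof.
rewrite inE; apply: (iffP andP) => [[eK]|[[f b] [/= -> eK <-]]].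
  by case/orP=> /andP[/eqP ev eA]; [exists (e, true)|exists (e, false)].
by rewrite /dart_src /dart_tgt eK; case: b => /= ->; rewrite eqxx ?orbT.
Qed.

Definition induced_edges A : {set edge G} :=
  [set e | (src e \in A) && (tgt e \in A)].

Lemma induced_edgesE A d :
  (d.1 \in induced_edges A) = (dart_src d \in A) && (dart_tgt d \in A).
Proof. by rewrite inE /dart_src /dart_tgt; case: d.2; rewrite // andbC. Qed.

Definition component A v : {set vertex G} :=
  [set w | connect (adj (induced_edges A)) v w].

Lemma mem_component A v : v \in component A v.
Proof. by rewrite inE connect0. Qed.

Lemma component_sub A v : v \in A -> component A v \subset A.
Proof.
move=> vA; apply/subsetP => w; rewrite inE => /connectP[q + ->].
elim: q v vA => //= u q IH v vA /andP[/adjP[d [dA _ <-]]]; apply: IH.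
by move: dA; rewrite induced_edgesE => /andP[].
Qed.

Lemma adj_component A v u w :
  u \in component A v -> adj (induced_edges A) u w -> w \in component A v.
Proof. by rewrite !inE => vu uw; apply: connect_trans vu (connect1 uw). Qed.

Lemma connect_component A v w : w \in component A v ->
  connect (adj (induced_edges (component A v))) v w.
Proof.
rewrite inE => /connectP[q vq ->]; apply/connectP; exists q => //.
have inC : all (mem (component A v)) (v :: q).
  by apply/allP => u /(path_connect vq) vu; rewrite /= inE.
apply: sub_in_path inC vq => u x uC xC /adjP[d [dA du dx]].
by apply/adjP; exists d; rewrite induced_edgesE du dx; split=> //; apply/andP.
Qed.

Lemma exits_component K A v w : v \in A -> w \in component A v ->
  exits K (component A v) w \subset exits K A w.
Proof.
move=> vA wC; apply/subsetP => e /exitsP[d [de eK dw dC]].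
apply/exitsP; exists d; split=> //; apply: contra dC => dA.
apply: adj_component (wC) _; apply/adjP; exists d; split=> //.
by rewrite induced_edgesE dA andbT dw; exact: (subsetP (component_sub vA)).
Qed.

End InducedSubgraphs.

Local Open Scope classical_set_scope.

(** * Darts and stars of a metric graph *)

Section Darts.
Context {R : realType} {Gamma : metricType R}.
Variable G : model Gamma.
Implicit Types (e : edge G) (d : dart G) (v : vertex G) (x : Gamma).
Implicit Types (s t : R).

Definition dart_rev d : dart G := (d.1, ~~ d.2).

Definition dart_par d t : Gamma := par d.1 (if d.2 then t else len d.1 - t).

Definition open_edge e : set Gamma := par e @` `]0, len e[.

Lemma dart_rev_neq d : dart_rev d != d.
Proof. by apply/eqP => /(congr1 snd) /=; case: d.2. Qed.

Lemma eq_dart_edge d d' : d.1 = d'.1 -> d' = d \/ d' = dart_rev d.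
Proof.
by case: d d' => [e b] [_ b'] /= <-; case: b b' => -[]; [left|right|right|left].
Qed.

Lemma dart_par_rev d t : dart_par (dart_rev d) t = dart_par d (len d.1 - t).
Proof. by rewrite /dart_par /=; case: d.2; rewrite //= opprB addrC subrK. Qed.

Lemma dart_par0 d : dart_par d 0 = vtx (dart_src d).
Proof.
by rewrite /dart_par /dart_src subr0; case: d.2; rewrite ?par_src ?par_tgt.
Qed.

Lemma dart_par_len d : dart_par d (len d.1) = vtx (dart_tgt d).
Proof.
by rewrite /dart_par /dart_tgt subrr; case: d.2; rewrite ?par_src ?par_tgt.
Qed.

Lemma closed_edgeP d x :
  closed_edge d.1 x <-> exists2 t, 0 <= t <= len d.1 & dart_par d t = x.
Proof.
rewrite /dart_par; case: d => e [] //=; split=> -[t /= tl <-].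
  by exists (len e - t); [lra|rewrite opprB addrC subrK].
by exists (len e - t) => //=; lra.
Qed.

Lemma open_edgeP d x :
  open_edge d.1 x <-> exists2 t, 0 < t < len d.1 & dart_par d t = x.
Proof.
rewrite /open_edge /dart_par; case: d => e [] /=; split=> -[t /=].
- by rewrite in_itv; exists t.
- by exists t; rewrite //= in_itv.
- rewrite in_itv /= => tl <-.
  by exists (len e - t); [lra|rewrite opprB addrC subrK].
- by move=> tl <-; exists (len e - t); rewrite //= in_itv /=; lra.
Qed.

Lemma open_edge_dart d t : 0 < t < len d.1 -> open_edge d.1 (dart_par d t).
Proof. by move=> tl; apply/open_edgeP; exists t. Qed.

Lemma closed_edge_dart d t : 0 <= t <= len d.1 ->
  closed_edge d.1 (dart_par d t).
Proof. by move=> tl; apply/closed_edgeP; exists t. Qed.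

Lemma open_edge_closed e x : open_edge e x -> closed_edge e x.
Proof.
by move=> [t /=]; rewrite in_itv => /andP[? ?] <-; exists t; rewrite //= !ltW.
Qed.

Lemma vtx_or_open_edge x : (exists v : vertex G, x = vtx v) \/
  exists e, open_edge e x.
Proof.
case: (model_cover G x) => [|[e [s [sl ->]]]]; first by left.
by right; exists e, s; rewrite //= in_itv.
Qed.

Lemma vtx_notin_open_edge e v : ~ open_edge e (vtx v).
Proof. by move=> [s /=]; rewrite in_itv; exact: vtx_notin_par. Qed.

Lemma dart_par_end d t : 0 <= t <= len d.1 ->
  [\/ 0 < t < len d.1, t = 0 | t = len d.1].
Proof.
move=> /andP[]; rewrite !le_eqVlt => /predU1P[<-|t0];
  first by move=> _; apply: Or32.
by move=> /predU1P[->|tl]; [apply: Or33|apply: Or31; rewrite t0].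
Qed.

Lemma dart_par_vtx d t v : 0 <= t <= len d.1 -> dart_par d t = vtx v ->
  t = 0 /\ v = dart_src d \/ t = len d.1 /\ v = dart_tgt d.
Proof.
move=> /dart_par_end[/open_edge_dart + tv|->|->].
- by rewrite tv => /vtx_notin_open_edge.
- by rewrite dart_par0 => /vtx_inj <-; left.
- by rewrite dart_par_len => /vtx_inj <-; right.
Qed.

Lemma open_edge_uniq e e' x : open_edge e x -> closed_edge e' x -> e' = e.
Proof.
move=> ex /(closed_edgeP (e', true))[t tl tx]; move: ex; rewrite -tx.
case: (dart_par_end tl) => [tl' [s /= +]|->|->].
- by rewrite in_itv => sl /(par_inj sl tl')[].
- by rewrite dart_par0 => /vtx_notin_open_edge.
- by rewrite dart_par_len => /vtx_notin_open_edge.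
Qed.

Lemma dart_par_inj d s t : 0 <= s <= len d.1 -> 0 <= t <= len d.1 ->
  dart_par d s = dart_par d t -> s = t.
Proof.
move=> sl tl st; have ends : vtx (dart_src d) <> vtx (dart_tgt d) :> Gamma.
  by move/vtx_inj/eqP; rewrite (negbTE (dart_src_neq_tgt d)).
have ends' := nesym ends.
have vtx_interior u v : 0 < u < len d.1 -> dart_par d u <> vtx v.
  by move=> /open_edge_dart + uv; rewrite uv => /vtx_notin_open_edge.
case: (dart_par_end sl) st => [sl'|->|->];
  case: (dart_par_end tl) => [tl'|->|->] //;
  rewrite ?dart_par0 ?dart_par_len => st //.
- by case: d sl' tl' st {sl tl ends ends' vtx_interior} => e [] /=
    sl tl /par_inj[]; lra.
- by case: (vtx_interior _ _ sl' st).
- by case: (vtx_interior _ _ sl' st).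
- by case: (vtx_interior _ _ tl' (esym st)).
- by case: (vtx_interior _ _ tl' (esym st)).
Qed.

Definition coord d x : R :=
  xget 0 [set t | 0 <= t <= len d.1 /\ dart_par d t = x].

Lemma coordP d x : closed_edge d.1 x ->
  0 <= coord d x <= len d.1 /\ dart_par d (coord d x) = x.
Proof.
move=> /closed_edgeP[t tl tx].
by apply: (@xgetPex _ 0 [set t | 0 <= t <= len d.1 /\ dart_par d t = x]);
  exists t.
Qed.

Lemma dart_parK d t : 0 <= t <= len d.1 -> coord d (dart_par d t) = t.
Proof.
move=> tl; have [cl] := coordP (closed_edge_dart tl); exact: dart_par_inj.
Qed.

Lemma coord_rev d x : closed_edge d.1 x ->
  coord (dart_rev d) x = len d.1 - coord d x.
Proof.
move=> dx; have [cl cx] := coordP dx; rewrite -{1}cx.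
rewrite -[X in dart_par d X](subKr (len d.1)) -dart_par_rev dart_parK//=; lra.
Qed.

Lemma coord_src d : coord d (vtx (dart_src d)) = 0.
Proof. by rewrite -dart_par0 dart_parK// lexx ltW// len_gt0. Qed.

Lemma open_edge_coord d x : open_edge d.1 x -> 0 < coord d x < len d.1.
Proof. by move=> /open_edgeP[t tl <-]; rewrite dart_parK//; lra. Qed.

Lemma dist_coord d s t : 0 <= s <= len d.1 -> 0 <= t <= len d.1 ->
  `|coord d (par d.1 t) - coord d (par d.1 s)| = `|t - s|.
Proof.
case: d => e b /= sl tl; rewrite -[par e s]/(dart_par (e, true) s).
rewrite -[par e t]/(dart_par (e, true) t); case: b; first by rewrite !dart_parK.
rewrite -[(e, false)]/(dart_rev (e, true)) !coord_rev;
  [|exact: (@closed_edge_dart (e, true))..].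
by rewrite !dart_parK// distrC; congr (`|_|); ring.
Qed.

End Darts.

Section Chains.
Context {R : realType} {Gamma : metricType R}.
Variable G : model Gamma.
Implicit Types (d : dart G) (x y : Gamma) (l r s t : R).

Local Notation chain := (chain (@par _ _ G)).

Lemma chain_ge0 x y l : chain x y l -> 0 <= l.
Proof. by elim=> // e s t l' _ _ _ l0; rewrite addr_ge0. Qed.

Lemma mdist_le_chain x y l : chain x y l -> mdist x y <= l.
Proof.
move=> xyl; rewrite (model_mdist G); apply: ge_inf => //.
by exists 0 => z /=; exact: chain_ge0.
Qed.

(* The infimum of an empty set of chains would be [0]. *)
Lemma mdist_lt_chain x y r : mdist x y < r -> exists2 l, chain x y l & l < r.
Proof.
have [->|/eqP xy] := eqVneq x y.
  by rewrite mdistxx; exists 0 => //; exact: chain_nil.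
rewrite (model_mdist G); apply: inf_lt.
apply/set0P; apply: contra_notN xy => /eqP noc.
by apply: mdist_positivity; rewrite (model_mdist G) noc inf0.
Qed.

Lemma mdist_dart_par d s t : 0 <= s <= len d.1 -> 0 <= t <= len d.1 ->
  mdist (dart_par d s) (dart_par d t) <= `|s - t|.
Proof.
case: d => e b /=; have mdist_par u w : 0 <= u <= len e -> 0 <= w <= len e ->
    mdist (par e u) (par e w) <= `|u - w|.
  move=> ul wl.
  have := mdist_le_chain (chain_step ul wl (chain_nil _ (par e u))).
  by rewrite add0r distrC.
move=> sl tl; rewrite /dart_par /=; case: b; first exact: mdist_par.
have -> : s - t = (len e - t) - (len e - s) by ring.
by rewrite distrC mdist_par//; lra.
Qed.

End Chains.

Section Stars.
Context {R : realType} {Gamma : metricType R}.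
Variable G : model Gamma.
Implicit Types (e : edge G) (d : dart G) (v : vertex G) (p x y : Gamma).
Implicit Types (a b l r s t u w : R).

Local Notation chain := (chain (@par _ _ G)).

(* The branches at [p] are the directions in which a dart through [p] can be
   followed beyond [p]; they stand for the tangent directions at [p]. *)
Definition branches p : {set dart G} :=
  [set d | `[< closed_edge d.1 p /\ coord d p < len d.1 >]]%SET.

Definition ray p d t : Gamma := dart_par d (coord d p + t).

Definition star_radius p r := 0 < r /\
  forall d, d \in branches p -> coord d p + r <= len d.1.

Lemma branchesP p d :
  reflect (closed_edge d.1 p /\ coord d p < len d.1) (d \in branches p).
Proof. by rewrite inE; exact: asboolP. Qed.

Lemma branches_vtx v d : (d \in branches (vtx v)) = (dart_src d == v).
Proof.
apply/branchesP/eqP => [[/coordP[cl]]|<-].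
  by move/(dart_par_vtx cl) => [[_ ->]//|[-> _]]; rewrite ltxx.
rewrite coord_src len_gt0 -dart_par0; split=> //; apply: closed_edge_dart.
by rewrite lexx ltW// len_gt0.
Qed.

Lemma branches_open_edge d p : open_edge d.1 p ->
  branches p = [set d; dart_rev d]%SET.
Proof.
move=> dp; apply/setP => d'; rewrite !inE; apply/asboolP/orP => [[d'p _]|].
  by case: (eq_dart_edge (esym (open_edge_uniq dp d'p))) => ->; [left|right].
have through : forall f : dart G, f.1 = d.1 ->
    closed_edge f.1 p /\ coord f p < len f.1.
  move=> f fd; rewrite -fd in dp; have /andP[_ ->] := open_edge_coord dp.
  by split=> //; exact: open_edge_closed.
by case=> /eqP ->; exact: through.
Qed.

Lemma ray0 p d : closed_edge d.1 p -> ray p d 0 = p.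
Proof. by move=> /coordP[_ cp]; rewrite /ray addr0. Qed.

Lemma ray_src d t : ray (vtx (dart_src d)) d t = dart_par d t.
Proof. by rewrite /ray coord_src add0r. Qed.

Lemma ray_dart_par d s t : 0 <= s <= len d.1 ->
  ray (dart_par d s) d t = dart_par d (s + t).
Proof. by move=> sl; rewrite /ray dart_parK. Qed.

Lemma ray_dart_par_rev d s t : 0 <= s <= len d.1 ->
  ray (dart_par d s) (dart_rev d) t = dart_par d (s - t).
Proof.
move=> sl; rewrite /ray coord_rev ?dart_parK//; last exact: closed_edge_dart.
by rewrite dart_par_rev; congr dart_par; ring.
Qed.

Lemma star_radius_exists p : exists r, star_radius p r.
Proof.
exists (\big[Order.min/1]_(d in branches p) (len d.1 - coord d p)); split.
  by apply: lt_bigmin => // d /branchesP[_]; rewrite subr_gt0.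
by move=> d db; rewrite -lerBrDl; exact: bigmin_le_cond.
Qed.

Lemma star_radius_le p r r' : star_radius p r -> 0 < r' <= r ->
  star_radius p r'.
Proof. by move=> [_ pr] /andP[r'0 r'r]; split=> // d /pr; lra. Qed.

Lemma ray_bound p r d t : star_radius p r -> d \in branches p -> 0 <= t <= r ->
  0 <= coord d p + t <= len d.1.
Proof.
by move=> [_ pr] db tr; have [/branchesP[/coordP[]]] := (db, pr _ db); lra.
Qed.

Lemma ray_open_edge p r d t : star_radius p r -> d \in branches p ->
  0 < t < r -> open_edge d.1 (ray p d t).
Proof.
move=> [_ pr] db tr; apply: open_edge_dart.
by have [/branchesP[/coordP[]]] := (db, pr _ db); lra.
Qed.

Lemma branches_rev p d : closed_edge d.1 p ->
  (dart_rev d \in branches p) = (0 < coord d p).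
Proof.
move=> dp; apply/branchesP/idP => [[_]|c0]; first by rewrite coord_rev//=; lra.
by split=> //=; rewrite coord_rev//; lra.
Qed.

(* The distance between [ray p d s] and [ray p d' t] near [p]. *)
Definition star_dist d s d' t : R := if d == d' then `|s - t| else s + t.

Lemma star_dist_le d s d' t : 0 <= s -> 0 <= t -> star_dist d s d' t <= s + t.
Proof.
by move=> s0 t0; rewrite /star_dist; case: ifP => // _; rewrite ler_norml; lra.
Qed.

Lemma star_dist_ge d s d' t : 0 <= s -> t - s <= star_dist d s d' t.
Proof.
move=> s0; rewrite /star_dist; case: ifP => _; last by lra.
by rewrite distrC ler_norm.
Qed.

Lemma star_dist_triangle d s d' t d'' u : 0 <= s -> 0 <= t -> 0 <= u ->
  star_dist d s d'' u <= star_dist d s d' t + star_dist d' t d'' u.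
Proof.
move=> s0 t0 u0; rewrite /star_dist.
have [<-|dd'] := eqVneq d d'.
  case: eqP => _; first exact: ler_distD.
  by have := ler_norm (s - t); lra.
have [<-|d'd''] := eqVneq d' d''.
  by rewrite (negbTE dd'); have := ler_norm (u - t); rewrite distrC; lra.
by case: eqP => _; [rewrite ler_norml; lra|lra].
Qed.

Lemma ray_toward p d w : closed_edge d.1 p -> 0 <= w <= len d.1 ->
  w != coord d p ->
  let d' := if coord d p < w then d else dart_rev d in
  d' \in branches p /\ dart_par d w = ray p d' `|w - coord d p|.
Proof.
move=> dp wl; have [cl _] := coordP dp; rewrite neq_lt => /orP[wc|cw].
  rewrite ltNge ltW//= branches_rev//; split; first by lra.
  by rewrite /ray coord_rev// dart_par_rev ltr0_norm ?subr_lt0//;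
    congr dart_par; ring.
rewrite cw; split; first by apply/branchesP; split=> //; lra.
by rewrite /ray gtr0_norm ?subr_gt0//; congr dart_par; ring.
Qed.

Lemma ray_edge p r d t e : star_radius p r -> d \in branches p -> 0 <= t < r ->
    closed_edge e (ray p d t) ->
  exists d', [/\ d'.1 = e, closed_edge e p, d' = d \/ t = 0 &
    coord d' (ray p d t) = coord d' p + t].
Proof.
move=> pr db /andP[t0 tr] ept; have /branchesP[dp _] := db.
have [t_eq|t_neq0] := eqVneq t 0.
  rewrite t_eq ray0// in ept *.
  by exists (e, true); split=> //; [right|rewrite addr0].
have e_d : e = d.1.
  apply: open_edge_uniq ept; apply: ray_open_edge pr db _.
  by rewrite tr lt0r t_neq0 t0.
exists d; rewrite e_d; split=> //; first by left.
by rewrite dart_parK//; apply: ray_bound pr db _; rewrite t0 ltW.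
Qed.

Lemma star_step p r d t e a b : star_radius p r -> d \in branches p -> 0 <= t ->
    0 <= a <= len e -> 0 <= b <= len e -> par e a = ray p d t ->
    t + `|b - a| < r ->
  exists d' u, [/\ d' \in branches p, 0 <= u, par e b = ray p d' u
    & star_dist d t d' u <= `|b - a|].
Proof.
move=> pr db t0 al bl ea tr; have /branchesP[dp _] := db.
have ept : closed_edge e (ray p d t) by rewrite -ea; exists a.
have tr' : 0 <= t < r by have := normr_ge0 (b - a); lra.
have [d1 [d1e ep d1t ct]] := ray_edge pr db tr' ept; subst e.
have [wl wb] := @coordP _ _ _ d1 (par d1.1 b) (ex_intro2 _ _ b bl erefl).
have := dist_coord al bl; rewrite ea ct => dw.
move: wl wb dw; set w := coord d1 _; set c := coord d1 p => wl wb dw.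
have [wc|wc] := eqVneq w c.
  exists d, 0; rewrite ray0// -wb wc (coordP ep).2; split=> //.
  have := star_dist_le d d t0 (lexx 0); rewrite addr0 => /le_trans; apply.
  by rewrite -dw wc opprD addNKr normrN ger0_norm.
have [d'b d'w] := ray_toward ep wl wc; rewrite -/c in d'b d'w.
exists (if c < w then d1 else dart_rev d1), `|w - c|; split=> //;
  first by rewrite -wb.
rewrite -dw; have sd := star_dist_le _ _ t0 (normr_ge0 (w - c)).
have [cw|wc'] := ltP c w; last first.
  suff <- : t + `|w - c| = `|w - (c + t)| by exact: sd.
  by rewrite !ler0_norm; lra.
case: d1t => [<-|t_eq]; last by rewrite t_eq add0r addr0 in sd *; exact: sd.
have tE : t - (w - c) = - (w - (c + t)) by ring.
by rewrite /star_dist eqxx [X in t - X]gtr0_norm ?subr_gt0// tE normrN.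
Qed.

Lemma chain_in_star p r d s y l : star_radius p r -> d \in branches p ->
    0 <= s -> chain (ray p d s) y l -> s + l < r ->
  exists d' t, [/\ d' \in branches p, 0 <= t, y = ray p d' t
    & star_dist d s d' t <= l].
Proof.
move=> pr db s0; elim=> {y l} [|e a b l al bl _ IH] sl.
  by exists d, s; rewrite /star_dist eqxx subrr normr0.
have [|d' [t [d'b t0 ea dt]]] := IH; first by have := normr_ge0 (b - a); lra.
have tr : t + `|b - a| < r by have := star_dist_ge d d' t s0; lra.
have [d'' [u [d''b u0 eb du]]] := star_step pr d'b t0 al bl ea tr.
exists d'', u; split=> //.
by apply: le_trans (star_dist_triangle d d' d'' s0 t0 u0) _; rewrite lerD.
Qed.

Lemma ray_inj p r d s d' t : star_radius p r -> d \in branches p ->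
    d' \in branches p -> 0 <= s < r -> 0 <= t < r -> ray p d s = ray p d' t ->
  star_dist d s d' t = 0.
Proof.
move=> pr db d'b /andP[s0 sr] /andP[t0 tr] st.
have d't : closed_edge d'.1 (ray p d s).
  by rewrite st; apply/closed_edge_dart/(ray_bound pr d'b); rewrite t0 ltW.
have [|d1 [d1d' ep d1d cs]] := ray_edge pr db _ d't; first by rewrite s0.
have ct : coord d' (ray p d s) = coord d' p + t.
  by rewrite st dart_parK//; apply: ray_bound pr d'b _; rewrite t0 ltW.
have [dd'|[-> ->]] : (d = d' /\ s = t) \/ (s = 0 /\ t = 0); last first.
  by rewrite /star_dist subrr normr0 addr0 if_same.
  by case: dd' => -> ->; rewrite /star_dist eqxx subrr normr0.
have [d'E|d'E] := eq_dart_edge d1d'; subst d'.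
  have s_eq : s = t by lra.
  by case: d1d => [->|s0']; [left|right; rewrite -s_eq].
right; move: ct; rewrite !coord_rev//; lra.
Qed.

Lemma chain_branch p y l : chain p y l -> y <> p -> exists d, d \in branches p.
Proof.
elim=> {y l} [//|e a b l al _ _ IH _].
have [ep|/eqP/IH//] := eqVneq (par e a) p.
have dp : closed_edge (e, true).1 p by exists a.
have [cl _] := coordP dp; have l0 := len_gt0 e.
have [c0|c0] := ltP 0 (coord (e, true) p).
  by exists (dart_rev (e, true)); rewrite branches_rev.
by exists (e, true); apply/branchesP; split=> //=; lra.
Qed.

Lemma mdist_rays p r d s d' t : star_radius p r -> d \in branches p ->
    d' \in branches p -> 0 <= s <= r / 3 -> 0 <= t <= r / 3 ->
  mdist (ray p d s) (ray p d' t) = star_dist d s d' t.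
Proof.
move=> pr db d'b sr tr; have [/branchesP[dp _] /branchesP[d'p _]] := (db, d'b).
have bound d1 u : d1 \in branches p -> 0 <= u <= r / 3 ->
    0 <= coord d1 p + u <= len d1.1.
  by move=> d1b ur; apply: ray_bound pr d1b _; lra.
apply/eqP; rewrite eq_le; apply/andP; split.
  have to_center d1 u : d1 \in branches p -> 0 <= u <= r / 3 ->
      mdist p (ray p d1 u) <= u.
    move=> d1b ur; have /branchesP[d1p _] := d1b.
    rewrite -{1}(ray0 d1p).
    apply: le_trans (mdist_dart_par _ _) _; try exact: bound.
      by apply: bound => //; lra.
    by rewrite opprD addrACA subrr add0r sub0r normrN ger0_norm//; lra.
  rewrite /star_dist; have [<-|_] := eqVneq d d'.
    by apply: le_trans (mdist_dart_par _ _) _;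
      rewrite ?bound// opprD addrACA subrr add0r.
  apply: le_trans (metric_triangle _ p _) _.
  by rewrite lerD ?to_center// metric_sym to_center.
rewrite leNgt; apply/negP => /(mdist_lt_chain G)[l st ll].
have stl : star_dist d s d' t <= s + t by apply: star_dist_le; lra.
have sl : s + l < r by lra.
have s0 : 0 <= s by lra.
have [d1 [u [d1b u0 u_t du]]] := chain_in_star pr db s0 st sl.
have us := star_dist_ge d d1 u s0.
have ut : star_dist d1 u d' t = 0.
  by apply: (ray_inj pr d1b d'b) (esym u_t); lra.
by have := star_dist_triangle d d1 d' s0 u0 (proj1 (andP tr)); lra.
Qed.

Lemma mdist_ray p r d t : star_radius p r -> d \in branches p ->
  0 <= t <= r / 3 -> mdist p (ray p d t) = t.
Proof.
move=> pr db tr; have /branchesP[dp _] := db.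
have zr : 0 <= (0 : R) <= r / 3 by lra.
rewrite -{1}(ray0 dp) (mdist_rays pr)//.
by rewrite /star_dist eqxx sub0r normrN ger0_norm//; lra.
Qed.

Lemma star_ball p r x : star_radius p r -> mdist p x < r / 3 -> x <> p ->
  exists2 d, d \in branches p & x = ray p d (mdist p x).
Proof.
move=> pr px xp; have [l pxl lr] := mdist_lt_chain G px.
have [d db] := chain_branch pxl xp; have /branchesP[dp _] := db.
rewrite -(ray0 dp) in pxl.
have [|d' [t [d'b t0 xt dt]]] := chain_in_star pr db (lexx 0) pxl;
  first by case: pr; lra.
have := star_dist_ge d d' t (lexx 0); rewrite subr0 => t_le.
by exists d'; rewrite // xt (mdist_ray pr)//; lra.
Qed.

End Stars.

(** * Tangent directions and local topology *)

Lemma near_right0P {R : realType} (P : R -> Prop) :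
  (\forall t \near (0 : R)^'+, P t) <->
  exists2 r : R, 0 < r & forall t, 0 < t < r -> P t.
Proof.
split=> [[r /= r0 rP]|[r r0 rP]].
  exists r => // t /andP[t0 tr]; apply: rP => //=.
  by rewrite sub0r normrN gtr0_norm.
near=> t; apply: rP; apply/andP; split; near: t; first exact: nbhs_right_gt.
exact: nbhs_right_lt.
Unshelve. all: by end_near. Qed.

Lemma near_right0N {R : realType} (P : R -> Prop) (r : R) :
  ~ (\forall t \near (0 : R)^'+, P t) ->
  0 < r -> exists2 t, 0 < t < r & ~ P t.
Proof.
move=> nP r0; apply: contrapT => nt; apply/nP/near_right0P; exists r => // t tr.
by apply: contrapT => nPt; apply: nt; exists t.
Qed.

Lemma near_right0_not {R : realType} (P : R -> Prop) :
  (\forall t \near (0 : R)^'+, P t) -> ~ \forall t \near (0 : R)^'+, ~ P t.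
Proof.
move=> Pnear /(filterI Pnear).
by move=> /(@filter_ex _ _ (at_right_proper_filter (0 : R)))[t []].
Qed.

Lemma nbhs_mdistP {R : realType} {Gamma : metricType R} (p : Gamma)
    (P : set Gamma) :
  nbhs p P <-> exists2 r : R, 0 < r & forall x, mdist p x < r -> P x.
Proof.
split=> [/nbhs_ballP[r /= r0 rP]|[r r0 rP]].
  by exists r => // x px; apply: rP; rewrite ballEmdist.
by apply/nbhs_ballP; exists r => //= x; rewrite ballEmdist; exact: rP.
Qed.

Lemma metric_finite_set_closed {R : realType} {Gamma : metricType R}
    (F : set Gamma) :
  finite_set F -> closed F.
Proof.
by have /accessible_finite_set_closed :=
  hausdorff_accessible (@metric_hausdorff R Gamma); apply.
Qed.

Section LocalTopology.
Context {R : realType} {Gamma : metricType R}.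
Variable G : model Gamma.
Implicit Types (d : dart G) (p x : Gamma) (r s t : R).
Implicit Types (X F : set Gamma) (gam : R -> Gamma).

Lemma near_mdist_ray p d : d \in branches G p ->
  \forall t \near (0 : R)^'+, mdist p (ray p d t) = t.
Proof.
move=> db; have [r pr] := star_radius_exists G p; have [r0 _] := pr.
apply/near_right0P; exists (r / 3); first by rewrite divr_gt0.
by move=> t tr; apply: mdist_ray pr db _; lra.
Qed.

Lemma nbhs_rayP p (P : set Gamma) : nbhs p P <->
  P p /\ forall d, d \in branches G p ->
    \forall t \near (0 : R)^'+, P (ray p d t).
Proof.
split=> [nP|[Pp Pray]].
  split=> [|d db]; first exact: nbhs_singleton.
  have [r r0 rP] := (nbhs_mdistP _ _).1 nP.
  near=> t; apply: rP; rewrite (_ : mdist _ _ = t); near: t.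
    exact: nbhs_right_lt.
  exact: near_mdist_ray.
have [r pr] := star_radius_exists G p; have [r0 _] := pr.
have /near_right0P[r' r'0 r'P] :
    \forall t \near (0 : R)^'+, forall d, d \in branches G p -> P (ray p d t).
  apply: filter_forall => d; have [/Pray|db] := boolP (d \in branches G p).
    by apply: filterS.
  by near=> t.
apply/nbhs_mdistP; exists (Num.min r' (r / 3)).
  by rewrite lt_min r'0 divr_gt0.
move=> x; rewrite lt_min => /andP[xr' xr].
have [->//|/eqP xp] := eqVneq x p; have [d db ->] := star_ball pr xr xp.
by apply: r'P => //; rewrite xr' mdist_gt0 eq_sym andbT; exact/eqP.
Unshelve. all: by end_near. Qed.

Lemma emanating_ray p d : d \in branches G p -> emanating p (ray p d).
Proof.
move=> db; have [r pr] := star_radius_exists G p; have [r0 _] := pr.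
have /branchesP[dp _] := db.
split; first exact: ray0.
exists (r / 3); first by rewrite divr_gt0.
by move=> s t sr tr; rewrite (mdist_rays pr)// /star_dist eqxx.
Qed.

(* A path of unit speed leaving along one branch cannot move to another one:
   the distance between the two is the sum of the distances to [p]. *)
Lemma emanating_along_ray p gam : emanating p gam ->
  exists2 d, d \in branches G p & same_direction (ray p d) gam.
Proof.
move=> [g0 [r1 r10 giso]]; have [r2 pr2] := star_radius_exists G p.
have [r20 _] := pr2; pose r := Num.min r1 r2.
have r0 : 0 < r by rewrite lt_min r10.
have rr1 : r <= r1 by rewrite ge_min lexx.
have pr : star_radius G p r.
  by apply: star_radius_le pr2 _; rewrite r0 ge_min lexx orbT.
have dist_g t : 0 <= t < r -> mdist p (gam t) = t.
  by move=> tr; rewrite -g0 giso ?sub0r ?normrN ?ger0_norm//; lra.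
have on_ray t : 0 < t < r / 3 ->
    exists2 d, d \in branches G p & gam t = ray p d t.
  move=> tr; have := star_ball pr (x := gam t); rewrite dist_g; last by lra.
  apply; first by lra.
  move=> gt; have := dist_g t; rewrite gt mdistxx => t0.
  by move: (tr); rewrite -t0 ?ltxx//; lra.
have [d db gd] : exists2 d, d \in branches G p & gam (r / 6) = ray p d (r / 6).
  by apply: on_ray; lra.
exists d => //; apply/near_right0P; exists (r / 6); first by lra.
move=> t tr; have [|d' d'b gd'] := on_ray t; first by lra.
have : mdist (gam t) (gam (r / 6)) = `|t - r / 6| by apply: giso; lra.
rewrite gd gd' (mdist_rays pr)//; [|lra..].
rewrite /star_dist; case: eqP => [->//|_].
rewrite ler0_norm => [tE|]; last by lra.
suff : r <= 0 by rewrite leNgt r0.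
by lra.
Qed.

Definition direction p d : set (R -> Gamma) :=
  emanating p `&` same_direction (ray p d).

Lemma same_direction_sym gam gam' : same_direction gam gam' ->
  same_direction gam' gam.
Proof. by apply: filterS => t ->. Qed.

Lemma same_direction_trans gam gam' gam'' :
  same_direction gam gam' -> same_direction gam' gam'' ->
  same_direction gam gam''.
Proof. by apply: filterS2 => t -> ->. Qed.

Lemma tangent_directionsE p :
  tangent_directions p =
    [set direction p d | d in [set d | d \in branches G p]].
Proof.
apply/seteqP; split=> [v [gam gp <-]|v [d db <-]]; last first.
  by exists (ray p d) => //; exact: emanating_ray.
have [d db dg] := emanating_along_ray gp; exists d => //.
rewrite /direction; apply/seteqP; split=> gam' [gp' gg']; split=> //.
  exact: same_direction_trans (same_direction_sym dg) gg'.
exact: same_direction_trans dg gg'.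
Qed.

Lemma direction_inj p : {in branches G p &, injective (direction p)}.
Proof.
move=> d d' db d'b dd'; have [r pr] := star_radius_exists G p.
have [_ same] : direction p d' (ray p d).
  by rewrite -dd'; split; [exact: emanating_ray|exact: nearW].
apply: contrapT => /eqP nd; apply: near_right0_not same _.
apply/near_right0P; exists (r / 3) => [|t tr rays_eq]; first by case: pr; lra.
have tr' : 0 <= t <= r / 3 by lra.
have := mdist_rays pr db d'b tr' tr'; rewrite -rays_eq mdistxx.
rewrite /star_dist (negbTE nd) => t0.
suff : t <= 0 by rewrite leNgt; case/andP: tr => ->.
by lra.
Qed.

Lemma leaves_direction X p d : d \in branches G p ->
  leaves X (direction p d) <-> \forall t \near (0 : R)^'+, ~ X (ray p d t).
Proof.
move=> db; split=> [|dX gam [_ dg]].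
  by apply; split; [exact: emanating_ray|exact: nearW].
by apply: filterS2 dX dg => t + <-.
Qed.

Lemma outdegE X p : outdeg X p =
  #|[set d in branches G p |
      `[< \forall t \near (0 : R)^'+, ~ X (ray p d t) >]]%SET|.
Proof.
set B := [set d in _ | _]%SET.
rewrite /outdeg (_ : [set v | _] = [set` [fset direction p d | d in B]%fset]).
  rewrite set_fsetK card_in_imfset ?enum_finmemE -?cardE//= => d d'.
  rewrite [d \in _]inE [d' \in _]inE => /andP[db _] /andP[d'b _].
  exact: direction_inj.
rewrite tangent_directionsE; apply/seteqP; split=> [v [[d db <-] dX]|v /=].
  apply/imfsetP; exists d => //=; rewrite inE db.
  exact/asboolP/leaves_direction.
move=> /imfsetP[d /=]; rewrite inE => /andP[db /asboolP dX] ->.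
split; first by exists d.
exact/leaves_direction.
Qed.

Lemma outdeg_le X p (B : {set dart G}) :
    (forall d, d \in branches G p -> d \notin B ->
       \forall t \near (0 : R)^'+, X (ray p d t)) ->
  (outdeg X p <= #|B|)%N.
Proof.
move=> XB; rewrite outdegE; apply/subset_leq_card/fintype.subsetP => d.
rewrite inE => /andP[db /asboolP dX]; apply: contraT => dB.
by case: (near_right0_not (XB _ db dB)).
Qed.

Lemma outdeg_branches X p :
    (forall d, d \in branches G p ->
       \forall t \near (0 : R)^'+, ~ X (ray p d t)) ->
  outdeg X p = #|branches G p|.
Proof.
move=> dX; rewrite outdegE; apply: eq_card => d; rewrite inE.
by have [/dX/asboolP ->|] := boolP (d \in branches G p).
Qed.

Lemma ray_avoids_finite F p d : finite_set F -> d \in branches G p ->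
  \forall t \near (0 : R)^'+, ~ F (ray p d t).
Proof.
move=> finF db.
have /(nbhs_rayP _)[_ /(_ d db) Fp] : nbhs p (~` (F `\ p)).
  apply: open_nbhs_nbhs; split; last by case=> _; exact.
  apply: closed_openC; apply: metric_finite_set_closed; exact: finite_setD.
near=> t => Ft; have : (~` (F `\ p)) (ray p d t) by near: t.
apply; split=> // pt; have : mdist p (ray p d t) = t.
  by near: t; exact: near_mdist_ray.
rewrite pt mdistxx => t0; suff : 0 < t by rewrite -t0 ltxx.
by near: t; exact: nbhs_right_gt.
Unshelve. all: by end_near. Qed.

End LocalTopology.

(** * Segments and connectedness *)

Section Segments.
Context {R : realType} {Gamma : metricType R}.
Variable G : model Gamma.
Implicit Types (e : edge G) (d : dart G) (u v : vertex G) (T : {set edge G}).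
Implicit Types (p x : Gamma) (X : set Gamma) (a b s t : R).

Definition dart_seg d a b : set Gamma := dart_par d @` `[a, b].

Lemma dart_par_continuous d a b : 0 <= a -> b <= len d.1 ->
  {within `[a, b], continuous (dart_par d)}.
Proof.
move=> a0 bl; apply/subspace_continuousP => s; rewrite /= in_itv /= => sab.
move=> P /nbhs_mdistP[r r0 rP]; rewrite /= /within /=.
apply/nbhs_ballP; exists r => //= t; rewrite /ball /= => st.
rewrite in_itv /= => tab; apply: rP; apply: le_lt_trans st.
by apply: mdist_dart_par; lra.
Qed.

Lemma closed_dart_seg d a b : 0 <= a -> b <= len d.1 -> closed (dart_seg d a b).
Proof.
move=> a0 bl; apply: compact_closed; first exact: metric_hausdorff.
by apply: continuous_compact (dart_par_continuous a0 bl) _;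
  exact: segment_compact.
Qed.

Lemma connected_dart_seg d a b : 0 <= a -> b <= len d.1 ->
  connected (dart_seg d a b).
Proof.
move=> a0 bl; apply: connected_continuous_connected (dart_par_continuous a0 bl).
exact: segment_connected.
Qed.

Lemma connected_component_dart_seg X d a b s t : 0 <= a -> b <= len d.1 ->
  a <= s <= b -> a <= t <= b -> dart_seg d a b `<=` X ->
  connected_component X (dart_par d s) (dart_par d t).
Proof.
move=> a0 bl sab tab sX; exists (dart_seg d a b); last first.
  by exists t; rewrite //= in_itv.
split=> //; last exact: connected_dart_seg.
by exists s; rewrite //= in_itv.
Qed.

Lemma closed_edge_seg d : closed_edge d.1 = dart_seg d 0 (len d.1).
Proof.
apply/seteqP; split=> x => [/closed_edgeP[t tl <-]|[t /=]].
  by exists t; rewrite //= in_itv.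
by rewrite in_itv => tl <-; exact: closed_edge_dart.
Qed.

Lemma open_dart_par d a b : 0 <= a -> b <= len d.1 ->
  open (dart_par d @` `]a, b[).
Proof.
move=> a0 bl; rewrite openE => x [s /=]; rewrite in_itv /= => sab <-.
have sl : 0 <= s <= len d.1 by lra.
apply/(nbhs_rayP G); split=> [|d']; first by exists s; rewrite //= in_itv.
have ds : open_edge d.1 (dart_par d s) by apply: open_edge_dart; lra.
rewrite (branches_open_edge ds) !inE => /orP[]/eqP ->; apply/near_right0P.
  exists (b - s); first by lra.
  move=> t tr; rewrite ray_dart_par//; exists (s + t) => //=.
  by rewrite in_itv /=; lra.
exists (s - a); first by lra.
move=> t tr; rewrite ray_dart_par_rev//; exists (s - t) => //=.
by rewrite in_itv /=; lra.
Qed.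

Lemma dart_seg_interior d a b s : 0 <= a -> b <= len d.1 -> a < s < b ->
  (dart_seg d a b)° (dart_par d s).
Proof.
move=> a0 bl sab; rewrite /interior nbhsE; exists (dart_par d @` `]a, b[).
  by split; [exact: open_dart_par|exists s; rewrite //= in_itv].
by apply: image_subset; exact: subset_itv_oo_cc.
Qed.

Lemma dart_seg_rev d a b :
  dart_seg (dart_rev d) (len d.1 - b) (len d.1 - a) = dart_seg d a b.
Proof.
apply/seteqP.
split=> x [t /=]; rewrite in_itv /= => tab <-; exists (len d.1 - t).
- by rewrite /= in_itv /=; lra.
- by rewrite dart_par_rev.
- by rewrite /= in_itv /=; lra.
- by rewrite dart_par_rev subKr.
Qed.

Lemma outdeg_dart_seg_start d a b : 0 < a -> a < b -> b < len d.1 ->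
  (outdeg (dart_seg d a b) (dart_par d a) <= 1)%N.
Proof.
move=> a0 ab bl; rewrite -(cards1 (dart_rev d)).
apply: (outdeg_le (G := G)) => d'.
rewrite (@branches_open_edge _ _ _ d); last by apply: open_edge_dart; lra.
rewrite !inE => /orP[]/eqP ->; rewrite ?eqxx// => _.
apply/near_right0P; exists (b - a); first by lra.
move=> t tr; rewrite ray_dart_par; last by lra.
by exists (a + t) => //=; rewrite in_itv /=; lra.
Qed.

Lemma outdeg_dart_seg_end d a b : 0 < a -> a < b -> b < len d.1 ->
  (outdeg (dart_seg d a b) (dart_par d b) <= 1)%N.
Proof.
move=> a0 ab bl.
have := @outdeg_dart_seg_start (dart_rev d) (len d.1 - b) (len d.1 - a).
by rewrite dart_seg_rev dart_par_rev subKr /=; apply; lra.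
Qed.

Lemma connected_sub_open_dart X d a b : connected X -> 0 <= a -> b <= len d.1 ->
    ~ X (dart_par d a) -> ~ X (dart_par d b) ->
    X `&` dart_par d @` `]a, b[ !=set0 -> X `<=` dart_par d @` `]a, b[.
Proof.
move=> Xco a0 bl nXa nXb Xab.
suff XE : X `&` dart_par d @` `]a, b[ = X by rewrite -XE => x [].
apply: Xco => //.
  by exists (dart_par d @` `]a, b[) => //; exact: open_dart_par.
exists (dart_seg d a b); first exact: closed_dart_seg.
apply/seteqP; split=> x [Xx [s /= sab sx]]; split=> //; exists s => //=.
  exact: subset_itv_oo_cc.
move: sab; rewrite !in_itv /= => /andP[le_as le_sb].
rewrite !lt_neqAle le_as le_sb !andbT; apply/andP; split; apply/eqP => sE.
  by apply: nXa; rewrite sE sx.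
by apply: nXb; rewrite -sE sx.
Qed.

(* A connected set cannot accumulate at [p] along a branch without eventually
   containing the branch: it would split between two missed points. *)
Lemma boundary_branch X p : closed X -> connected X -> boundary X p ->
  exists2 d, d \in branches G p & \forall t \near (0 : R)^'+, ~ X (ray p d t).
Proof.
move=> Xcl Xco [clXp nXp]; have Xp : X p by exact: Xcl.
have [d db nd] :
    exists2 d, d \in branches G p & ~ \forall t \near (0 : R)^'+, X (ray p d t).
  apply: contrapT => nex; apply: nXp; apply/(nbhs_rayP G); split=> // d db.
  by apply: contrapT => nd; apply: nex; exists d.
exists d => //; apply: contrapT => nd'.
have [r pr] := star_radius_exists G p; have [r0 _] := pr.
have /branchesP[/coordP[cl cp] _] := db.
have [t3 t3r nX3] := near_right0N nd r0.
have t30 : 0 < t3 by case/andP: t3r.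
have [t2 t23 /contrapT X2] := near_right0N nd' t30.
have t20 : 0 < t2 by case/andP: t23.
have [t1 t12 nX1] := near_right0N nd t20.
have bound t : 0 < t < r -> 0 <= coord d p + t <= len d.1.
  by move=> tr; apply: ray_bound pr db _; lra.
have [b1 b3] : 0 <= coord d p + t1 <= len d.1 /\ 0 <= coord d p + t3 <= len d.1.
  by split; apply: bound; lra.
have [a0 bl] : 0 <= coord d p + t1 /\ coord d p + t3 <= len d.1 by lra.
have meets : X `&` dart_par d @` `]coord d p + t1, coord d p + t3[ !=set0.
  by exists (ray p d t2); split=> //; exists (coord d p + t2);
    rewrite //= in_itv /=; lra.
have [s /=] := connected_sub_open_dart Xco a0 bl nX1 nX3 meets Xp.
rewrite in_itv /= => sr sp; have : s = coord d p.
  by apply: (@dart_par_inj _ _ _ d); rewrite ?cp//; lra.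
by lra.
Qed.

Lemma connected_component_connect X T u v : X (vtx u) ->
    (forall e, e \in T -> closed_edge e `<=` X) -> connect (adj T) u v ->
  connected_component X (vtx u) (vtx v).
Proof.
move=> + TX /connectP[q + ->]; elim: q u => [|w q IH] u Xu /=.
  by move=> _; exact: connected_component_refl.
case/andP => /adjP[d [dT du dw]] wq.
have dX := TX _ dT; have l0 := ltW (len_gt0 d.1).
have sub_uw : dart_seg d 0 (len d.1) `<=` X by rewrite -closed_edge_seg.
apply: (@connected_component_trans _ _ (vtx w)).
  rewrite -du -dw -dart_par0 -dart_par_len.
  by apply: connected_component_dart_seg sub_uw; rewrite ?lexx ?l0.
apply: IH wq; rewrite -dw -dart_par_len; apply: sub_uw.
by exists (len d.1); rewrite //= in_itv /= lexx l0.
Qed.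

Lemma connected_of_vertices X u :
    (forall v, X (vtx v) -> connected_component X (vtx u) (vtx v)) ->
    (forall x, X x -> (exists v : vertex G, x = vtx v) \/ exists d t,
       [/\ 0 <= t <= len d.1, x = dart_par d t & dart_seg d 0 t `<=` X]) ->
  connected X.
Proof.
move=> Xvtx Xseg.
suff -> : X = connected_component X (vtx u) by exact: component_connected.
apply/seteqP; split; last exact: connected_component_sub.
move=> x Xx; have [[v xv]|[d [t [/andP[t0 tl] -> sX]]]] := Xseg x Xx.
  by rewrite xv in Xx *; exact: Xvtx.
have Xsrc : X (vtx (dart_src d)).
  by rewrite -dart_par0; apply: sX; exists 0; rewrite //= in_itv /= lexx.
apply: connected_component_trans (Xvtx _ Xsrc) _; rewrite -dart_par0.
by apply: connected_component_dart_seg sX; rewrite ?lexx ?t0.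
Qed.

End Segments.

(** * Divisors with connected complement are universally reduced *)

Definition support {T : choiceType} (D : {freeg T}) : set T :=
  [set x | coeff x D != 0].

Lemma finite_support {T : choiceType} (D : {freeg T}) : finite_set (support D).
Proof.
apply: sub_finite_set (finite_seq (dom D)) => x /=.
by rewrite mem_dom.
Qed.

Section ConnectedComplement.
Context {R : realType} {Gamma : metricType R}.
Variable G : model Gamma.
Implicit Types (D : {freeg Gamma}) (X A : set Gamma) (p q x y : Gamma).

Lemma connected_disjoint_boundary A X :
  connected A -> A `&` boundary X = set0 ->
  A `<=` X \/ A `<=` ~` X.
Proof.
move=> Aco AX; have [[x AXx]|noAX] := pselect (A `&` X !=set0); last first.
  by right=> x Ax Xx; apply: noAX; exists x.
have clAX y : A y -> closure X y -> X° y.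
  move=> Ay clXy; apply: contrapT => nXy.
  by have : (A `&` boundary X) y by []; rewrite AX.
suff AE : A `&` X = A by left; rewrite -AE => y [].
apply: Aco; first by exists x.
  exists X°; first exact: open_interior.
  apply/seteqP; split=> y [Ay Xy]; split=> //; last exact: interior_subset.
  exact: clAX Ay (subset_closure Xy).
exists (closure X); first exact: closed_closure.
apply/seteqP; split=> y [Ay Xy]; split=> //; first exact: subset_closure.
exact: interior_subset (clAX _ Ay Xy).
Qed.

(* The boundary of a set that can fire lies in the support of [D], so the set
   contains the complement of the support or is contained in the support. *)
Lemma q_reduced_of_connected_complement D q :
    (forall x, 0 <= coeff x D) -> connected (~` support D) ->
    (forall x, support D x -> coeff x D < #|branches G x|%:Z) ->
  q_reduced q D.
Proof.
move=> D_ge0 Dco D_lt; split=> [p _//|X [x0 Xx0] Xcl Xco nXq].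
apply: contrapT => nfire.
have outdeg_D p : boundary X p -> (outdeg X p)%:Z <= coeff p D.
  by move=> Xp; rewrite leNgt; apply/negP => lt; apply: nfire; exists p.
have bdX : ~` support D `&` boundary X = set0.
  apply/seteqP; split=> // p [Dp Xp]; apply: Dp.
  have [d db dX] := boundary_branch G Xcl Xco Xp.
  rewrite /support /= gt_eqF//; apply: lt_le_trans (outdeg_D _ Xp).
  rewrite (outdegE G) ltz_nat; apply/card_gt0P; exists d.
  by rewrite inE db; exact/asboolP.
have avoid p d := @ray_avoids_finite _ _ G _ p d (finite_support D).
have some_branch x : support D x -> exists d, d \in branches G x.
  by move=> Dx; apply/card_gt0P; rewrite -ltz_nat;
    apply: le_lt_trans (D_ge0 x) (D_lt x Dx).
case: (connected_disjoint_boundary Dco bdX) => [DX|XD].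
  have Dq : support D q by apply: contrapT => /DX.
  have [d db] := some_branch q Dq.
  have [_ /(_ d db)] :=
    (nbhs_rayP G q _).1 (open_nbhs_nbhs (conj (closed_openC Xcl) nXq)).
  by apply: near_right0_not; apply: filterS (avoid q d db) => t /DX.
have {}XD x : X x -> support D x by move=> Xx; apply: contrapT => /XD.
have Xavoid x d : d \in branches G x ->
    \forall t \near (0 : R)^'+, ~ X (ray x d t).
  by move=> /avoid; apply: filterS => t nD /XD.
have Xx0_bd : boundary X x0.
  split; first exact: subset_closure.
  have [d db] := some_branch x0 (XD x0 Xx0).
  by move=> /(nbhs_rayP G)[_ /(_ d db)/near_right0_not]; apply; exact: Xavoid.
apply: nfire; exists x0 => //; rewrite (@outdeg_branches _ _ G);
  first exact/D_lt/XD.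
exact: Xavoid.
Qed.

End ConnectedComplement.

Section GenericBreakDivisors.
Context {R : realType} {Gamma : metricType R}.
Variables (G : model Gamma) (T : {set edge G}).
Variables (I : finType) (f : I -> edge G) (x : I -> Gamma).
Hypothesis T_connected : forall u v, connect (adj T) u v.
Hypothesis f_inj : injective f.
Hypothesis f_notin : forall i, f i \notin T.
Hypothesis x_open : forall i, open_edge (f i) (x i).

Let D : {freeg Gamma} := \sum_i << x i >>.

Lemma open_edge_points_inj : injective x.
Proof.
move=> i j ij; apply: f_inj; apply: (@open_edge_uniq _ _ G _ _ (x j)) => //.
by rewrite -ij; exact: open_edge_closed.
Qed.

Lemma coeff_sum_points y : coeff y D = \sum_i (x i == y)%:Z.
Proof.
by rewrite /D raddf_sum; apply: eq_bigr => i _; rewrite /= coeffU mul1r natz.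
Qed.

Lemma support_sum_points : support D = range x.
Proof.
apply/seteqP; split=> [y|y [i _ <-]]; last first.
  by rewrite /support /= coeff_sum_points (bigD1 i)//=
    eqxx gt_eqF// ltr_wpDr// sumr_ge0.
apply: contraPP => ny; rewrite /support /= coeff_sum_points big1 ?eqxx// => i _.
by case: eqP => // xy; case: ny; exists i.
Qed.

Lemma connected_compl_points : connected (~` range x).
Proof.
have /card_gt0P[u _] := vertex_gt0 G.
apply: (@connected_of_vertices _ _ G _ u) => [v _|y ny].
  apply: connected_component_connect (T_connected u v) =>
    [[i _ xu]|e eT y ey [i _ xy]].
    by have := x_open i; rewrite xu => /vtx_notin_open_edge.
  rewrite -xy in ey; have := f_notin i.
  by rewrite -(open_edge_uniq (x_open i) ey) eT.
have [|[e ye]] := vtx_or_open_edge G y; [by left|right].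
suff [d [de before]] : exists d : dart G, d.1 = e /\
    forall i, f i = e -> coord d y < coord d (x i).
  have yd : closed_edge d.1 y by rewrite de; exact: open_edge_closed.
  have [cl cy] := coordP yd.
  exists d, (coord d y); split=> // z [s /=].
  rewrite in_itv /= => sy <- [i _ xs].
  have sl : 0 <= s <= len d.1 by lra.
  have fe : f i = e.
    apply/esym/(open_edge_uniq (x_open i)).
    by rewrite xs -de; exact: closed_edge_dart.
  by have := before i fe; rewrite xs dart_parK//; lra.
have [[i fe]|nf] := pselect (exists i, f i = e); last first.
  by exists (e, true); split=> // i fe; case: nf; exists i.
have only_i j : f j = e -> j = i by rewrite -fe => /f_inj.
have ye' := open_edge_closed ye; have xe : closed_edge e (x i).
  by rewrite -fe; exact: open_edge_closed.
have [yc|xc] := ltP (coord (e, true) y) (coord (e, true) (x i)).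
  by exists (e, true); split=> // j /only_i ->.
exists (dart_rev (e, true)); split=> // j /only_i ->.
rewrite !coord_rev// ltrD2l ltrN2 lt_neqAle xc andbT; apply/eqP => xy.
apply: ny; exists i => //.
rewrite -[LHS](@coordP _ _ _ (e, true) _ xe).2.
by rewrite -[RHS](@coordP _ _ _ (e, true) _ ye').2 xy.
Qed.

Lemma q_reduced_sum_points q : q_reduced q D.
Proof.
apply: (@q_reduced_of_connected_complement _ _ G) => [y||y].
- by rewrite coeff_sum_points sumr_ge0.
- by rewrite support_sum_points; exact: connected_compl_points.
rewrite support_sum_points => -[i _ <-].
rewrite (@branches_open_edge _ _ G (f i, true) (x i) (x_open i)) cards2.
rewrite eq_sym dart_rev_neq coeff_sum_points (bigD1 i)//= eqxx big1// => j ji.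
by rewrite (inj_eq open_edge_points_inj) (negbTE ji).
Qed.

End GenericBreakDivisors.

(** * Universally reduced divisors are break divisors of every model *)

Definition break_divisor_of {R : realType} {Gamma : metricType R}
    (G : model Gamma) (D : {freeg Gamma}) : Prop :=
  exists (T : {set edge G}) (p : edge G -> Gamma),
    [/\ spanning_tree T, forall e, e \notin T -> closed_edge e (p e)
      & D = \sum_(e | e \notin T) << p e >>].

Section ReducedDivisor.
Context {R : realType} {Gamma : metricType R}.
Variables (G : model Gamma) (D : {freeg Gamma}).
Hypothesis D_ge0 : forall x, 0 <= coeff x D.
Hypothesis D_red : forall q, q_reduced q D.
Implicit Types (e : edge G) (d : dart G) (v : vertex G) (A : {set vertex G}).
Implicit Types (p x : Gamma) (s t u : R).

Local Notation head := (head (@src _ G) (@tgt _ G)).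
Local Notation exits := (exits (@src _ G) (@tgt _ G)).
Local Notation indegree := (indegree (@src _ G) (@tgt _ G)).
Local Notation unfireable := (unfireable (@src _ G) (@tgt _ G)).

Lemma coeff_open_edge_le1 e x : open_edge e x -> coeff x D <= 1.
Proof.
move=> ex; have [||||p [+ _]] := (D_red (vtx (src e))).2 [set x].
- by exists x.
- exact: metric_finite_set_closed (finite_set1 x).
- exact: connected1.
- by move=> /= vx; rewrite -vx in ex; exact: vtx_notin_open_edge ex.
rewrite -(closure_id _).1 => [->|];
  last exact: metric_finite_set_closed (finite_set1 x).
have : (outdeg [set x] x <= #|branches G x|)%N by apply: outdeg_le => d ->.
rewrite (@branches_open_edge _ _ G (e, true))// cards2 eq_sym dart_rev_neq.
by lia.
Qed.

(* The segment between two chips of an open edge could fire. *)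
Lemma coeff_dart_seg_ends_le0 d s t : 0 < s -> s < t -> t < len d.1 ->
  coeff (dart_par d s) D <= 0 \/ coeff (dart_par d t) D <= 0.
Proof.
move=> s0 st tl; have [a0 bl] : 0 <= s /\ t <= len d.1 by lra.
have [||||p [clp nip]] := (D_red (vtx (dart_src d))).2 (dart_seg d s t).
- by exists (dart_par d s), s; rewrite //= in_itv /= lexx ltW.
- exact: closed_dart_seg.
- exact: connected_dart_seg.
- move=> [u /=]; rewrite in_itv /= => stu uv.
  apply: (@vtx_notin_open_edge _ _ G d.1 (dart_src d)); rewrite -uv.
  by apply: open_edge_dart; lra.
have [u /=] : dart_seg d s t p by exact: (closed_dart_seg a0 bl).
rewrite in_itv /= => stu up; subst p.
have [us|us] := eqVneq u s.
  by have := outdeg_dart_seg_start s0 st tl; rewrite us; left; lia.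
have [ut|ut] := eqVneq u t.
  by have := outdeg_dart_seg_end s0 st tl; rewrite ut; right; lia.
case: nip; apply: dart_seg_interior => //.
by rewrite !lt_neqAle eq_sym us ut.
Qed.

Definition chips e : set Gamma := [set x | open_edge e x /\ 0 < coeff x D].

Definition chip e : Gamma := xget (vtx (src e)) (chips e).

Definition chip_edges : {set edge G} := [set e | `[< chips e !=set0 >]]%SET.

Lemma chipP e : e \in chip_edges ->
  open_edge e (chip e) /\ coeff (chip e) D = 1.
Proof.
rewrite inE => /asboolP[x ex].
have [ec c_gt0] : chips e (chip e) by apply: xgetPex; exists x.
by split=> //; have := coeff_open_edge_le1 ec; lia.
Qed.

Lemma chip_uniq e x : chips e x -> e \in chip_edges /\ x = chip e.
Proof.
move=> [ex x_gt0]; have eC : e \in chip_edges.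
  by rewrite inE; apply/asboolP; exists x.
split=> //; have [ec c1] := chipP eC; pose d : dart G := (e, true).
have ends y z : open_edge e y -> open_edge e z ->
    0 < coeff y D -> 0 < coeff z D ->
    ~ coord d y < coord d z.
  move=> ey ez y_gt0 z_gt0 yz.
  have /andP[y0 _] := @open_edge_coord _ _ _ d _ ey.
  have /andP[_ zl] := @open_edge_coord _ _ _ d _ ez.
  have [_ cy] := @coordP _ _ _ d _ (open_edge_closed ey).
  have [_ cz] := @coordP _ _ _ d _ (open_edge_closed ez).
  by case: (coeff_dart_seg_ends_le0 y0 yz zl);
    rewrite ?cy ?cz leNgt ?y_gt0 ?z_gt0.
have c_gt0 : 0 < coeff (chip e) D by rewrite c1.
have [xc|cx|xc] := ltgtP (coord d x) (coord d (chip e)).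
- by case: (ends x (chip e)).
- by case: (ends (chip e) x).
have [_ <-] := @coordP _ _ _ d _ (open_edge_closed ex).
by have [_ <-] := @coordP _ _ _ d _ (open_edge_closed ec); rewrite xc.
Qed.

Lemma coeff_open_edge e x : open_edge e x ->
  coeff x D = ((e \in chip_edges) && (x == chip e))%:Z.
Proof.
move=> ex; have [x_gt0|x_le0] := ltP 0 (coeff x D).
  have [eC xc] := chip_uniq (conj ex x_gt0); rewrite eC {2}xc eqxx.
  by rewrite xc (chipP eC).2.
have -> : coeff x D = 0 by apply/le_anti; rewrite x_le0 D_ge0.
have [eC|//] := boolP (e \in chip_edges); case: eqP => //= xc.
by move: x_le0; rewrite xc (chipP eC).2.
Qed.

Lemma divisor_decomposition :
  D = \sum_(v : vertex G) << coeff (vtx v) D *g vtx v >>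
    + \sum_(e in chip_edges) << chip e >>.
Proof.
apply/eqP/freeg_eqP => x; rewrite raddfD /= !raddf_sum /=.
under eq_bigr do rewrite coeffU.
under [X in _ + X]eq_bigr do rewrite coeffU mul1r.
have [[v ->]|[e ex]] := vtx_or_open_edge G x.
  rewrite (bigD1 v)//= eqxx mulr1 big1 => [|w wv]; last first.
    by rewrite (inj_eq (@vtx_inj _ _ G)) (negbTE wv) mulr0.
  rewrite big1 ?addr0// => e /chipP[ec _].
  by case: eqP => // ev; rewrite ev in ec; case: (vtx_notin_open_edge ec).
rewrite big1 ?add0r => [|v _]; last first.
  case: eqP => [vx|]; rewrite ?mulr0//.
  by rewrite -vx in ex; case: (vtx_notin_open_edge ex).
have only_e f : f \in chip_edges -> chip f = x -> f = e.
  by move=> /chipP[fc _] fx; rewrite -fx in ex;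
    exact: open_edge_uniq ex (open_edge_closed fc).
rewrite (coeff_open_edge ex).
have [eC|eC] := boolP (e \in chip_edges); last first.
  rewrite big1// => f fC; case: eqP => // /(only_e _ fC) fe.
  by rewrite -fe fC in eC.
rewrite (bigD1 e)//= big1 => [|f /andP[fC fe]]; last first.
  by case: eqP => // /(only_e _ fC) f_e; rewrite f_e eqxx in fe.
by rewrite addr0 natz eq_sym.
Qed.

(* The part of the dart [d] issuing from [A] that is fired together with [A]:
   up to the chip of the edge, or up to [A] again. *)
Definition reach A d : R :=
  if dart_tgt d \in A then len d.1
  else if d.1 \in chip_edges then coord d (chip d.1) else 0.

Definition hull A : set Gamma :=
  [set vtx v | v in [set` A]] `|`
  \bigcup_(d in [set d : dart G | dart_src d \in A]) dart_seg d 0 (reach A d).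

Lemma coord_chip d : d.1 \in chip_edges -> 0 < coord d (chip d.1) < len d.1.
Proof. by move=> /chipP[/open_edge_coord]. Qed.

Lemma reach_bound A d : 0 <= reach A d <= len d.1.
Proof.
have l0 := len_gt0 d.1; rewrite /reach; case: ifP => _; first by lra.
by case: ifP => [/coord_chip|_]; lra.
Qed.

Lemma reach_gt0 A d : (dart_tgt d \in A) || (d.1 \in chip_edges) ->
  0 < reach A d.
Proof.
rewrite /reach; case: ifP => [_ _|_ /= dC]; first exact: len_gt0.
by rewrite dC; case/andP: (coord_chip dC).
Qed.

Lemma reach_lt_len A d : (reach A d < len d.1) = (dart_tgt d \notin A).
Proof.
rewrite /reach; case: ifP => _; first by rewrite ltxx.
by case: ifP => [/coord_chip/andP[_ ->]|_]; rewrite ?len_gt0.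
Qed.

Lemma hull_dart A d t : dart_src d \in A -> 0 <= t <= reach A d ->
  hull A (dart_par d t).
Proof.
by move=> dA tr; right; exists d => //; exists t; rewrite //= in_itv.
Qed.

Lemma hull_vtx A v : hull A (vtx v) <-> v \in A.
Proof.
split=> [[[w wA /vtx_inj <-]//|[d dA [t /=]]]|vA]; last by left; exists v.
have := reach_bound A d; rewrite in_itv /= => rl tr.
move=> /dart_par_vtx[|[_ ->//]|[tl ->]].
  by lra.
by rewrite -[_ \in A]negbK -reach_lt_len -leNgt; lra.
Qed.

Lemma closed_hull A : closed (hull A).
Proof.
apply: closedU; first by apply: metric_finite_set_closed; exact: finite_image.
apply: closed_bigcup => [|d _]; first exact: finite_finset.
by apply: closed_dart_seg => //; case/andP: (reach_bound A d).
Qed.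

Lemma connected_hull A v : v \in A ->
    {in A, forall w, connect (adj (induced_edges A)) v w} ->
  connected (hull A).
Proof.
move=> vA Aconn.
apply: (@connected_of_vertices _ _ G _ v) => [w /hull_vtx wA|x].
  apply: connected_component_connect (Aconn w wA); first exact/hull_vtx.
  move=> e eA x /(closed_edgeP (e, true))[t tl <-].
  move: (eA); rewrite -[e]/(e, true).1 induced_edgesE => /andP[dA tA].
  by apply: hull_dart; rewrite // /reach tA.
move=> [[w _ <-]|[d dA [t /=]]]; first by left; exists w.
have := reach_bound A d; rewrite in_itv /= => rl tr <-; right.
exists d, t; split=> //; first by lra.
by move=> y [s /=]; rewrite in_itv /= => st <-; apply: hull_dart => //; lra.
Qed.

(* At the chip that ends it, the hull leaves its edge in one direction only. *)
Lemma hull_firing_vtx A p : boundary (hull A) p ->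
  coeff p D < (outdeg (hull A) p)%:Z -> exists2 v, v \in A & p = vtx v.
Proof.
move=> [/(closed_hull (A := A)) hp nip] fire.
case: hp => [[v vA <-]|[d dA [u /=]]]; first by exists v.
have rl := reach_bound A d; rewrite in_itv /= => ur up; subst p.
have ul : 0 <= u <= len d.1 by lra.
case: (dart_par_end ul) => [u_open|u0|u_len]; last 2 first.
- by exists (dart_src d); rewrite ?u0 ?dart_par0.
- exists (dart_tgt d); rewrite ?u_len ?dart_par_len//.
  by rewrite -[_ \in A]negbK -reach_lt_len -leNgt; lra.
have [ur'|ur'] := eqVneq u (reach A d); last first.
  have [_ rl'] := andP rl; case: nip.
  apply: filterS (dart_seg_interior (lexx 0) rl' (_ : 0 < u < reach A d)) =>
    [y yd|].
    by right; exists d.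
  by rewrite lt_neqAle ur'; lra.
have dC : dart_tgt d \notin A /\ d.1 \in chip_edges.
  have tA : dart_tgt d \notin A by rewrite -reach_lt_len; lra.
  by split=> //; apply: contraT => dC; move: u_open;
    rewrite ur' /reach (negbTE tA) (negbTE dC) ltxx.
have [ec c1] := chipP dC.2.
suff : (outdeg (hull A) (dart_par d u) <= 1)%N.
  have : coeff (dart_par d u) D = 1.
    rewrite ur' /reach (negbTE dC.1) dC.2.
    by have [_ ->] := coordP (open_edge_closed ec).
  by lia.
rewrite -(cards1 d); apply: (outdeg_le (G := G)) => d'.
rewrite (@branches_open_edge _ _ _ d); last exact: open_edge_dart.
rewrite !inE => /orP[]/eqP ->; rewrite ?eqxx// => _.
apply/near_right0P; exists u; first by lra.
by move=> t tu; rewrite ray_dart_par_rev//; apply: hull_dart => //; lra.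
Qed.

Lemma outdeg_hull_vtx A v : v \in A ->
  (outdeg (hull A) (vtx v) <= #|exits (~: chip_edges) A v|)%N.
Proof.
move=> vA; pose B : {set dart G} := [set d |
  [&& dart_src d == v, dart_tgt d \notin A & d.1 \notin chip_edges]]%SET.
have B_inj : {in B &, injective (fun d : dart G => d.1)}.
  move=> [e b] [e' b']; rewrite !inE /dart_src /dart_tgt /=.
  move=> /and3P[/eqP dv tA _] /and3P[/eqP dv' _ _] ee'; subst e'.
  by case: b b' dv dv' tA => -[] //= _ ->; rewrite vA.
apply: (@leq_trans #|B|); last first.
  rewrite -(card_in_imset B_inj); apply/subset_leq_card/fintype.subsetP => e.
  case/imsetP => d; rewrite inE => /and3P[/eqP dv dA dC] ->.
  by apply/exitsP; exists d; rewrite finset.in_setC.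
apply: (outdeg_le (G := G)) => d; rewrite branches_vtx => /eqP dv.
rewrite inE dv eqxx /= negb_and !negbK => /reach_gt0 r0.
apply/near_right0P; exists (reach A d) => // t tr.
by rewrite -dv ray_src; apply: hull_dart; rewrite ?dv//; lra.
Qed.

Lemma unfireable_vtx_coeff :
  unfireable (~: chip_edges) (fun v => `|coeff (vtx v) D|%N).
Proof.
move=> A /set0Pn[v vA] AT; pose C := component A v.
have [w wA] : exists w, w \notin A.
  apply/existsP; apply: contraR AT => /existsPn AT.
  by apply/eqP/setP => w; rewrite inE; apply/negPn.
have CA := component_sub vA.
have [||||p bd_p fire] := (D_red (vtx w)).2 (hull C).
- by exists (vtx v); apply/hull_vtx/mem_component.
- exact: closed_hull.
- by apply: connected_hull (mem_component A v) _ => u; exact: connect_component.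
- by move/hull_vtx/(fintype.subsetP CA); exact/negP.
have [u uC pu] := hull_firing_vtx bd_p fire; subst p.
exists u; first exact: (fintype.subsetP CA).
rewrite -ltz_nat gez0_abs//; apply: lt_le_trans fire _; rewrite lez_nat.
apply: leq_trans (outdeg_hull_vtx uC) _.
exact/subset_leq_card/exits_component.
Qed.

Lemma card_edges_no_chip : deg D = (genus G)%:Z ->
  (#|~: chip_edges|%SET.+1 =
    \sum_v `|coeff (vtx (v : vertex G)) D| + #|vertex G|)%N.
Proof.
rewrite {1}divisor_decomposition raddfD /= !raddf_sum /=.
under eq_bigr do rewrite degU -[coeff _ _]gez0_abs//.
under [X in _ + X]eq_bigr do rewrite degU.
rewrite -(big_morph Posz PoszD erefl) sumr_const natz -PoszD => -[].
have := cardsC chip_edges; have := card_vertex_le G; rewrite /genus.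
by move: #|vertex G| => nb_vtx; lia.
Qed.

Lemma closed_edge_head (o : edge G -> bool) e :
  closed_edge e (vtx (head o e) : Gamma).
Proof.
have := len_gt0 e; rewrite /head; case: (o e) => l0.
  by exists (len e); rewrite ?par_tgt//=; lra.
by exists 0; rewrite ?par_src//=; lra.
Qed.

Lemma reduced_break_divisor_of : deg D = (genus G)%:Z -> break_divisor_of G D.
Proof.
move=> /card_edges_no_chip cardK.
have [T [o [T_tree TK o_deg]]] :=
  unfireable_spanning_tree cardK unfireable_vtx_coeff.
exists T, (fun e => if e \in chip_edges then chip e else vtx (head o e)).
split=> // [e _|].
  case: ifP => [/chipP[ec _]|_]; first exact: open_edge_closed.
  exact: closed_edge_head.
rewrite {1}divisor_decomposition [RHS](bigID (mem chip_edges)) /= [RHS]addrC.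
have chip_T e : e \in chip_edges -> e \notin T.
  by move=> eC; apply/negP => /(fintype.subsetP TK); rewrite finset.in_setC eC.
congr (_ + _); last first.
  rewrite [RHS](eq_bigl (mem chip_edges)) => [|e].
    by apply: eq_bigr => e ->.
  by rewrite /=; have [/chip_T ->|] := boolP (e \in chip_edges); rewrite ?andbF.
rewrite (partition_big (head o) xpredT)//=; apply: eq_bigr => v _.
transitivity (\sum_(e in [set e in (~: chip_edges) :\: T |
    head o e == v]%SET) << (vtx v : Gamma) >> : {freeg Gamma}).
  by rewrite sumr_const -/(indegree (~: chip_edges :\: T)%SET o v) o_deg
    freegU_muln natz gez0_abs.
apply: eq_big => [e|e];
  rewrite finset.in_set finset.in_setD finset.in_setC ?[mem _ _]unfold_in //.
by move=> /andP[/andP[_ /negbTE ->] /eqP ->].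
Qed.

End ReducedDivisor.

(** * Closure in the symmetric product *)

Lemma exists_enumeration (E : finType) (B : {set E}) (n : nat) : #|B| = n ->
  exists f : 'I_n -> E, injective f /\ [set f i | i : 'I_n]%SET = B.
Proof.
move=> <-; exists enum_val; split; first exact: enum_val_inj.
apply/setP => e; apply/imsetP/idP => [[i _ ->]|eB]; first exact: enum_valP.
by exists (enum_rank_in eB e); rewrite ?enum_rankK_in.
Qed.

Lemma sum_notin_enumeration {I E : finType} {V : nmodType} (T : {set E})
    (f : I -> E) (F : E -> V) :
  injective f -> [set f i | i : I]%SET = (~: T)%SET ->
  \sum_(e | e \notin T) F e = \sum_i F (f i).
Proof.
move=> f_inj fT; transitivity (\sum_(e in [set f i | i : I]%SET) F e).
  by rewrite fT; apply: eq_bigl => e; rewrite finset.in_setC.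
by rewrite big_imset //= => i j _ _; exact: f_inj.
Qed.

Lemma ptws_cvg {I U : choiceType} {T : topologicalType} (F : set_system U)
    (gam : U -> {ptws I -> T}) (p : {ptws I -> T}) : Filter F ->
  (forall i, gam t i @[t --> F] --> p i) -> gam @ F --> p.
Proof.
move=> FF gam_p; apply/cvg_sup => i A /=.
rewrite (@nbhsE (initial_topology (fun f : I -> T => f i))) =>
  -[B [[C C_open CB] Bp] BA].
apply: filterS BA _; rewrite -CB in Bp *.
by apply: (gam_p i); exact: open_nbhs_nbhs.
Qed.

Section SymmetricProduct.
Context {R : realType} {Gamma : metricType R} {g : nat}.
Variable G : model Gamma.
Implicit Types (p : 'I_g -> Gamma) (T : {set edge G}) (f : 'I_g -> edge G).
Implicit Types (D : Divplus Gamma g).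

Lemma sum_points_continuous :
  continuous (@sum_points Gamma g : {ptws 'I_g -> Gamma} -> Divplus Gamma g).
Proof. by apply/continuousP => U; rewrite open_DivplusE. Qed.

Lemma break_divisor_ofP p :
  break_divisor_of G (divisor (sum_points p : Divplus Gamma g)) <->
  exists T f, [/\ spanning_tree T, injective f,
    [set f i | i : 'I_g]%SET = (~: T)%SET & forall i, closed_edge (f i) (p i)].
Proof.
split=> [[T [x [T_tree xe DE]]]|[T [f [T_tree f_inj fT pe]]]].
  have cardT : #|(~: T)%SET| = g.
    have /andP[_ /eqP] := sum_points_subproof p.
    rewrite -[X in deg X]/(divisor (sum_points p : Divplus Gamma g)) DE
      raddf_sum /=.
    under eq_bigr do rewrite degU.
    rewrite sumr_const natz => -[<-].
    by apply: eq_card => e; rewrite finset.in_setC.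
  have [f [f_inj fT]] := exists_enumeration cardT.
  have /sum_points_fibre[s ->] : sum_points (x \o f) = sum_points p.
    apply: val_inj; rewrite -[RHS]/(divisor (sum_points p : Divplus Gamma g)).
    by rewrite DE (sum_notin_enumeration _ f_inj fT).
  exists T, (f \o s); split=> //; first exact: inj_comp f_inj perm_inj.
    rewrite -fT; apply/setP => e; apply/imsetP/imsetP => -[i _ ->];
      first by exists (s i).
    by exists (s^-1%g i); rewrite //= permKV.
  move=> i; apply: xe; rewrite -finset.in_setC -fT; exact: imset_f.
exists T, (fun e => if [pick i | f i == e] is Some i then p i else vtx (src e)).
have pick_f i : [pick j | f j == f i] = Some i.
  by case: pickP => [j /eqP/f_inj ->//|/(_ i)]; rewrite eqxx.
split=> // [e|]; last first.
  rewrite (sum_notin_enumeration _ f_inj fT).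
  by apply: eq_bigr => i _; rewrite pick_f.
by rewrite -finset.in_setC -fT => /imsetP[i _ ->]; rewrite pick_f.
Qed.

Lemma closed_closed_edge (e : edge G) : closed (closed_edge e).
Proof. by rewrite (closed_edge_seg (e, true)); exact: closed_dart_seg. Qed.

Lemma closed_break_divisor_of :
  closed [set D : Divplus Gamma g | break_divisor_of G (divisor D)].
Proof.
pose Tf := [set Tf : {set edge G} * {ffun 'I_g -> edge G} |
  [/\ spanning_tree Tf.1, injective Tf.2
    & [set Tf.2 i | i : 'I_g]%SET = (~: Tf.1)%SET]].
rewrite -openC open_DivplusE -[X in open X]setCK openC.
rewrite (_ : ~` _ = \bigcup_(x in Tf) \bigcap_i
    [set p : {ptws 'I_g -> Gamma} | closed_edge (x.2 i) (p i)]).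
  apply: closed_bigcup => [|x _]; first exact: finite_finset.
  apply: closed_bigI => i _.
  rewrite (_ : [set p | _] = proj i @^-1` closed_edge (x.2 i))//.
  apply: preimage_closed; last exact: closed_closed_edge.
  by move=> p _; exact: proj_continuous.
apply/seteqP; split=> p.
  move=> /contrapT/break_divisor_ofP[T [f [T_tree f_inj fT pe]]].
  exists (T, [ffun i => f i]) => [|i _] /=; last by rewrite ffunE.
  split=> //= [i j|]; first by rewrite !ffunE => /f_inj.
  by rewrite -fT; apply: eq_imset => i; rewrite ffunE.
move=> [[T f] /= [T_tree f_inj fT] pe]; apply; apply/break_divisor_ofP.
by exists T, f; split=> // i; exact: pe.
Qed.

Lemma closed_edge_approx (e : edge G) x : closed_edge e x ->
  exists gam : R -> Gamma, gam t @[t --> (0 : R)^'+] --> x /\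
    \forall t \near (0 : R)^'+, open_edge e (gam t).
Proof.
move=> [u /= ul <-]; have l0 := len_gt0 e.
pose near_u t := Num.max t (Num.min (len e - t) u).
have near_uP t : 0 < t < len e / 2 ->
    0 < near_u t < len e /\ `|u - near_u t| <= t.
  move=> tl; rewrite /near_u ler_norml.
  by have [lu|lu] := leP (len e - t) u; case: (leP t) => tu; split; lra.
exists (par e \o near_u); split; last first.
  apply/near_right0P; exists (len e / 2); first by lra.
  by move=> t /near_uP[tl _]; exists (near_u t); rewrite //= in_itv.
move=> A /nbhs_mdistP[r r0 rA].
apply/near_right0P; exists (Num.min r (len e / 2)).
  by rewrite lt_min r0; lra.
move=> t; rewrite lt_min => /and3P[t0 tr tl]; apply: rA; apply: le_lt_trans tr.
have [|nl nt] := near_uP t; first by rewrite t0.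
by apply: le_trans nt; apply: (@mdist_dart_par _ _ _ (e, true)) => //=; lra.
Qed.

Lemma break_divisor_in_closure D : break_divisor_of G (divisor D) ->
  closure [set D : Divplus Gamma g | universally_reduced g (divisor D)] D.
Proof.
have [p <-] := sum_points_surj D.
move=> /break_divisor_ofP[T [f [[T_connected _] f_inj fT pe]]].
have /choice[gam gamP] := fun i => closed_edge_approx (pe i).
have gam_cvg : (fun i => gam i t) @[t --> (0 : R)^'+] -->
    (p : {ptws 'I_g -> Gamma}).
  apply: ptws_cvg => i; exact: (gamP i).1.
have sum_cvg :
    (sum_points (fun i => gam i t) : Divplus Gamma g) @[t --> (0 : R)^'+] -->
    (sum_points p : Divplus Gamma g).
  exact: (continuous_cvg _ (@sum_points_continuous p) gam_cvg).
apply: (closed_cvg _ (@closed_closure _ _) _ _ sum_cvg).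
have : \forall t \near (0 : R)^'+, forall i, open_edge (f i) (gam i t).
  by apply: filter_forall => i; exact: (gamP i).2.
apply: filterS => t t_open; apply: subset_closure.
have /andP[eff /eqP deg_g] := sum_points_subproof (fun i => gam i t).
split=> // q; apply: q_reduced_sum_points T_connected f_inj _ t_open q => i.
by rewrite -finset.in_setC -fT imset_f.
Qed.

End SymmetricProduct.

Theorem theorem4p17 (R : realType) (Gamma : metricType R) (g : nat)
    (hGamma : metric_graph Gamma g) :
  [set D : Divplus Gamma g | break_divisor (divisor D)]
  = closure [set D : Divplus Gamma g | universally_reduced g (divisor D)].
Proof.
have [G genus_g] := hGamma; apply/seteqP; split=> D.
  move=> [G' D_break]; exact: break_divisor_in_closure D_break.
move=> D_closure; exists G; apply: closed_break_divisor_of.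
apply: closureS D_closure => D' [deg_g /fgposP D'_ge0 D'_red].
by apply: reduced_break_divisor_of; rewrite ?genus_g.
Qed.
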